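(* Let $\kappa\in\mathbb{N}\cup\{\infty\}$ and let $\sigma^{(0)}=(\sigma^{(0)}_i)_{i\in\mathbb{N}_0}$ be an initial consistent stopping family, i.e. a family of $\mathbb{G}$-stopping times with $i\le\sigma^{(0)}_i<\infty$ and $\sigma^{(0)}_i>i\Rightarrow\sigma^{(0)}_i=\sigma^{(0)}_{i+1}$ for all $i\in\mathbb{N}_0$ (for example, the myopic choice $\sigma^{(0)}_i=i$, $i\in\mathbb{N}_0$). Define recursively, for $m\in\mathbb{N}_0$ and $i\in\mathbb{N}_0$, $$\sigma_i^{(m+1)}:=\inf\left\{j\ge i:\ U_j\ge\max_{j\le k\le j+\kappa}\mathbb{E}_{\mathcal{G}_j}\left[U_{\sigma_k^{(m)}}\right]\right\}.$$ Let $(\sigma_i^{\ast})$ denote the family of (first) optimal stopping times, that is, $$\sigma_i^{\ast}:=\inf\left\{j\ge i:\ U_j\ge\mathbb{E}_{\mathcal{G}_j}[Y_{j+1}]\right\}.$$ Then, for the sequence $(\sigma^{(m)})_{m\in\mathbb{N}_0}$, we have $$\sigma_i^{(m)}\le\sigma_i^{(m+1)}\le\sigma_i^{\ast}<\infty,\qquad m\in\mathbb{N}_0,$$ and moreover it holds that $$\sigma_i^{\ast}=\uparrow\lim_{m\to\infty}\sigma_i^{(m)}\quad\text{and}\quad Y_i=\uparrow\lim_{m\to\infty}Y_i^{(m)},$$ with $Y_i^{(m)}:=\mathbb{E}_{\mathcal{G}_i}\left[U_{\sigma_i^{(m)}}\right]$. The up-arrows indicate that the respective sequences are non-decreasing.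
   Context: $\mathbb{N}=\{1,2,\dots\}$, $\mathbb{N}_0=\mathbb{N}\cup\{0\}$; $\mathbb{E}_{\mathcal{H}}$ denotes conditional expectation given $\mathcal{H}$. $(\Omega,\mathcal{F},\mathbb{F},\mathbb{P})$ is a filtered probability space with $\mathbb{F}=(\mathcal{F}_t)_{0\le t\le\infty}$ satisfying the usual conditions. $(\tau_i)_{i\in\mathbb{N}_0}$ is a sequence of $\mathbb{F}$-stopping times with, a.s., $\tau_0=0$, $\tau_i<\tau_{i+1}<\infty$ for all $i\in\mathbb{N}_0$, and $\lim_{i\to\infty}\tau_i=\infty$. $T\in(0,\infty)$ is a fixed horizon. $Z=(Z_t)_{0\le t<\infty}$ is a non-negative $\mathbb{F}$-adapted reward process, càdlàg on $[0,T]$, with $Z_t=0$ a.s. for $t>T$. Standing integrability assumption: $\mathbb{E}[\sup_{i\in\mathbb{N}_0}Z_{\tau_i}^{\alpha}]\le B^{\alpha}$ for some $B>0$ and $\alpha>1$. $U_i:=Z_{\tau_i}$, $\mathcal{G}_i:=\mathcal{F}_{\tau_i}$ (the stopping-time $\sigma$-algebra), $\mathbb{G}:=(\mathcal{G}_i)_{i\in\mathbb{N}_0}$, and $\mathcal{N}$ is the set of $\mathbb{N}_0$-valued $\mathbb{G}$-stopping times. The Snell envelope is $Y_i:=\operatorname{ess\,sup}_{\mathfrak{n}\in\mathcal{N},\ \mathfrak{n}\ge i}\mathbb{E}_{\mathcal{G}_i}[U_{\mathfrak{n}}]$. For $\kappa=\infty$, the maximum over $j\le k\le j+\kappa$ is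 over all integers $k\ge j$. (In)equalities and limits of random variables are understood almost surely.
   Formalization: For m=0 the inequality σ_i^(0) ≤ σ_i^(1) (hence σ_i^(0) ≤ σ_i^* ) can fail; it is proved only if a.s. σ_j^(0)>j implies U_j < max_{j≤k≤j+κ} E_{G_j}[U_{σ_k^(0)}] for all j, as for the myopic choice. For m≥1 σ^(m) is non-decreasing without this. *)

(* Defs.v *)
(* MathComp-Analysis *)
From HB Require Import structures.
From mathcomp Require Export all_boot all_order all_algebra.
From mathcomp Require Export all_classical all_reals all_analysis measurable_realfun.
Import Order.TTheory GRing.Theory Num.Theory.
Export numFieldNormedType.Exports.

Set Implicit Arguments.
Unset Strict Implicit.
Unset Printing Implicit Defensive.

Local Open Scope classical_set_scope.
Local Open Scope ring_scope.
Local Open Scope ereal_scope.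

Section conditional_expectation.
Context {d : measure_display} {Omega : measurableType d} {R : realType}.
Variable P : probability Omega R.
Implicit Types (G : set (set Omega)) (X Y : Omega -> \bar R).

Definition is_condexp G X Y :=
  [/\ forall B : set (\bar R), measurable B -> G (Y @^-1` B),
      P.-integrable setT Y &
      forall A, G A -> \int[P]_(w in A) Y w = \int[P]_(w in A) X w].

(* A fixed version of the conditional expectation of X given the sub-sigma-algebra
   G; by Radon-Nikodym one exists as soon as X is integrable, and it is unique up
   to a P-null set. The value for other X is a dummy. *)
Definition condexp G X : Omega -> \bar R := xget (cst 0) [set Y | is_condexp G X Y].

Definition is_esssup (D : set (Omega -> \bar R)) Y :=
  [/\ measurable_fun setT Y,
      forall X, D X -> {ae P, forall w, X w <= Y w} &
      forall Y', measurable_fun setT Y' ->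
        (forall X, D X -> {ae P, forall w, X w <= Y' w}) ->
        {ae P, forall w, Y w <= Y' w}].

(* The essential supremum of a family of random variables (again a fixed version;
   one always exists when the members are measurable). Not to be confused with
   [ess_sup], which is the essential supremum of one function. *)
Definition esssup (D : set (Omega -> \bar R)) : Omega -> \bar R :=
  xget (cst 0) [set Y | is_esssup D Y].

End conditional_expectation.

Section continuous_time.
Context {d : measure_display} {Omega : measurableType d} {R : realType}.
Variable P : probability Omega R.
(* time runs through [0, +oo]; the values at negative times are irrelevant *)
Variable F : \bar R -> set (set Omega).

Definition filtration :=
  [/\ forall t, 0 <= t -> sigma_algebra setT (F t),
      forall t, 0 <= t -> F t `<=` measurable &
      forall s t, 0 <= s -> s <= t -> F s `<=` F t].

(* [P.-negligible] ranges over all subsets of null events, so the second clause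
   also says that the probability space is complete. *)
Definition usual_conditions :=
  (forall t, 0 <= t -> t < +oo -> F t = \bigcap_(s in [set s | t < s]) F s) /\
  (forall A, P.-negligible A -> F 0 A).

Definition stopping_time (tau : Omega -> \bar R) :=
  (forall w, 0 <= tau w) /\ (forall t, 0 <= t -> F t [set w | tau w <= t]).

(* the instance t = +oo says that A belongs to F +oo *)
Definition stopping_sigma (tau : Omega -> \bar R) : set (set Omega) :=
  [set A | forall t, 0 <= t -> F t (A `&` [set w | tau w <= t])].

Definition adapted (Z : R -> Omega -> R) :=
  forall t : R, (0 <= t)%R ->
  forall B : set R, measurable B -> F t%:E (Z t @^-1` B).

End continuous_time.

Definition cadlag_on {R : realType} (T : R) (z : R -> R) :=
  (forall t : R, (0 <= t < T)%R -> z x @[x --> t^'+] --> z t) /\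
  (forall t : R, (0 < t <= T)%R -> cvg (z x @[x --> t^'-])).

(* The event times increase strictly from 0 to infinity. *)
Definition event_times {d : measure_display} {Omega : measurableType d}
    {R : realType} (P : probability Omega R) (F : \bar R -> set (set Omega))
    (tau : nat -> Omega -> \bar R) :=
  [/\ forall i, stopping_time F (tau i),
      {ae P, forall w, tau 0%N w = 0},
      forall i, {ae P, forall w, tau i w < tau i.+1 w /\ tau i.+1 w < +oo} &
      {ae P, forall w, tau i w @[i --> \oo] --> +oo}].

Definition reward_process {d : measure_display} {Omega : measurableType d}
    {R : realType} (P : probability Omega R) (F : \bar R -> set (set Omega))
    (T : R) (Z : R -> Omega -> R) :=
  [/\ forall t w, (0 <= t)%R -> (0 <= Z t w)%R,
      adapted F Z,
      {ae P, forall w, cadlag_on T (Z ^~ w)} &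
      {ae P, forall w, forall t, (T < t)%R -> Z t w = 0%R}].

(* U_i = Z_{tau_i}; the value on the null event tau_i = +oo is a dummy *)
Definition sampled_reward {Omega : Type} {R : realType} (Z : R -> Omega -> R)
    (tau : nat -> Omega -> \bar R) (i : nat) (w : Omega) : \bar R :=
  (Z (fine (tau i w)) w)%:E.

Section discrete_time.
Context {d : measure_display} {Omega : measurableType d} {R : realType}.
Variable P : probability Omega R.
Variable G : nat -> set (set Omega).
Variable U : nat -> Omega -> \bar R.

(* Random times with values in {0, 1, 2, ...} U {+oo} are functions into \bar R. *)
Definition discrete_stopping_time (n : Omega -> \bar R) :=
  (forall w, n w = +oo \/ exists k : nat, n w = k%:R%:E) /\
  (forall i : nat, G i [set w | n w <= i%:R%:E]).

(* U_n, set to 0 where n is infinite *)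
Definition stopped (n : Omega -> \bar R) (w : Omega) : \bar R :=
  if n w is r%:E then U (Num.truncn r) w else 0.

Definition snell (i : nat) : Omega -> \bar R :=
  esssup P [set condexp P (G i) (stopped n) | n in
    [set n | [/\ discrete_stopping_time n, (forall w, n w < +oo) &
                 {ae P, forall w, i%:R%:E <= n w}]]].

Definition consistent_family (sigma : nat -> Omega -> \bar R) :=
  [/\ forall i, discrete_stopping_time (sigma i),
      forall i, {ae P, forall w, i%:R%:E <= sigma i w /\ sigma i w < +oo} &
      forall i, {ae P, forall w, i%:R%:E < sigma i w ->
                                 sigma i w = sigma i.+1 w}].

(* inf {j >= i : S j}, with inf set0 = +oo *)
Definition first_from (i : nat) (S : nat -> Prop) : \bar R :=
  ereal_inf [set j%:R%:E | j in [set j | (i <= j)%N /\ S j]].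

(* {k : j <= k <= j + kappa}; [None] stands for kappa = infinity *)
Definition window (kappa : option nat) (j : nat) : set nat :=
  [set k | (j <= k)%N /\ if kappa is Some K then (k <= j + K)%N : Prop else True].

(* max_{j <= k <= j + kappa} E_{G_j} [U_{sigma_k}] *)
Definition lookahead (kappa : option nat) (sigma : nat -> Omega -> \bar R)
    (j : nat) (w : Omega) : \bar R :=
  ereal_sup [set condexp P (G j) (stopped (sigma k)) w | k in window kappa j].

(* The family continues at j only where U_j lies strictly below the maximum. This
   holds for sigma_j = j, but a consistent family may overshoot: with deterministic
   U = (1, 0, 0, ...) and sigma_0 = sigma_1 = 1, one update moves sigma_0 from 1
   back to 0. *)
Definition no_overshoot (kappa : option nat) (sigma : nat -> Omega -> \bar R) :=
  forall j, {ae P, forall w, j%:R%:E < sigma j w ->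
                             U j w < lookahead kappa sigma j w}.

Fixpoint policy (kappa : option nat) (sigma0 : nat -> Omega -> \bar R) (m : nat)
    : nat -> Omega -> \bar R :=
  if m is m'.+1 then
    fun i w => first_from i
      (fun j => lookahead kappa (policy kappa sigma0 m') j w <= U j w)
  else sigma0.

Definition optimal_time (i : nat) (w : Omega) : \bar R :=
  first_from i (fun j => condexp P (G j) (snell j.+1) w <= U j w).

Definition policy_value (kappa : option nat) (sigma0 : nat -> Omega -> \bar R)
    (m i : nat) : Omega -> \bar R :=
  condexp P (G i) (stopped (policy kappa sigma0 m i)).

End discrete_time.

(* Main.v *)
(* Put V_i := lim_m Y_i^(m). The policies are consistent, so a window term of
   L_j = max_(j <= k <= j + kappa) E_(G_j) [U_(sigma_k)] is at most the maximum of
   U_j and E_(G_j) [L_(j+1)]; optional stopping at the first j with L_j <= U_j then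
   gives L^(m) <= Y^(m+1), hence monotonicity in m. Let sigma^oo_i be the first
   j >= i such that L_j^(m) <= U_j for all m: for almost every w it equals
   sigma_i^(m) for all large m, so V_i = E_(G_i) [U_(sigma^oo_i)]. Moreover V is a
   supermartingale dominating U, hence dominates E_(G_i) [U_n] for all n >= i, and
   as it is attained it is the Snell envelope Y; finally {U_j >= E_(G_j) [Y_(j+1)]}
   and {U_j >= L_j^(m) for all m} agree almost surely, i.e. sigma^oo = sigma^*.
   All the times are finite because U_k = 0 for all k >= j on the G_j-event
   {tau_j > T}. *)
From HB Require Import structures.
Require Import Defs.
Set Implicit Arguments.
Unset Strict Implicit.
Unset Printing Implicit Defensive.
Import Order.TTheory GRing.Theory Num.Theory.
Local Open Scope classical_set_scope.
Local Open Scope ring_scope.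
Local Open Scope ereal_scope.

(** * Conditional expectation given a sub-sigma-algebra *)

(** The difficulty is to pass to the limit under conditional expectations. The stopping times are
    unbounded, so optional stopping is run only up to a deterministic index n, with a continuation
    payoff on {n <= t}. The natural payoffs are L_n and V_n, but L_n is bounded by the conditional
    expectation of M = sup_k U_k, not by M itself. Before n tends to infinity they are therefore
    exchanged: L_n for M, which only raises the value, and V_n for 0, which only lowers it. As m
    tends to infinity the rewards U_(sigma^(m)) converge almost surely but not monotonically;
    monotone are their conditional expectations, and domination by M identifies their limit. M is
    integrable because z <= 1 + z^alpha.

    The values increase from m = 0 on. The times increase as soon as the family does not overshoot,
    and after one update it never does, because L^(m) <= L^(m+1).

    Every relation holds almost surely between chosen versions. Null events belong to every G_i, so
    a modification on a null event stays a stopping time. *)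

Lemma ae_le_integral d (T : measurableType d) (R : realType)
    (mu : {measure set T -> \bar R}) (D : set T) (f g : T -> \bar R) :
  measurable D -> mu.-integrable D f -> mu.-integrable D g ->
  {ae mu, forall x, D x -> f x <= g x} ->
  \int[mu]_(x in D) f x <= \int[mu]_(x in D) g x.
Proof.
move=> mD intf intg [N [mN N0 subN]].
rewrite (negligible_integral mN mD intf N0) (negligible_integral mN mD intg N0).
have mDN : measurable (D `\` N) by exact: measurableD.
apply: le_integral => //; try exact: integrableS.
  by apply: (integrableS mD) => // x [].
  by apply: (integrableS mD) => // x [].
move=> x /set_mem[Dx Nx]; apply: contrapT => h; apply: Nx; apply: subN => /=.
by move=> /(_ Dx).
Qed.

Lemma ae_le_integrable d (T : measurableType d) (R : realType)
    (mu : {measure set T -> \bar R}) (D : set T) (mD : measurable D)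
    (f g : T -> \bar R) :
  measurable_fun D f -> {ae mu, forall x, D x -> `|f x| <= `|g x|} ->
  mu.-integrable D g -> mu.-integrable D f.
Proof.
move=> mf fg /integrableP[mg gfin]; apply/integrableP; split => //.
apply: le_lt_trans gfin; apply: ae_ge0_le_integral => //; exact: measurableT_comp.
Qed.

(** On the event where g < f the difference is positive while its integral is at most 0, so the
    event is null. All later comparisons of conditional expectations test on this event, which is
    G-measurable when f and g are. *)
Lemma integral_le_ae_le d (T : measurableType d) (R : realType)
    (mu : {measure set T -> \bar R}) (D : set T) (f g : T -> \bar R) :
  measurable D -> mu.-integrable D f -> mu.-integrable D g ->
  \int[mu]_(x in D `&` [set x | g x < f x]) f x <=
    \int[mu]_(x in D `&` [set x | g x < f x]) g x ->
  {ae mu, forall x, D x -> f x <= g x}.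
Proof.
move=> mD intf intg; set C := D `&` _ => le_fg.
have subx_gt0 (x y : \bar R) : y < x -> 0 <= x - y.
  case: x y => [a||] [b||]; last first; try by rewrite ?ltxx ?ltNge ?leey ?leNye.
  by rewrite lte_fin lee_fin subr_ge0 => /ltW.
have subx_neq0 (x y : \bar R) : y < x -> x - y <> 0.
  case: x y => [a||] [b||]; last first; try by rewrite ?ltxx ?ltNge ?leey ?leNye.
  by rewrite lte_fin => ab [] /eqP; rewrite subr_eq0 gt_eqF.
have mf := measurable_int _ intf; have mg := measurable_int _ intg.
have mC : measurable C by exact: measurable_lte.
have CD : C `<=` D by move=> x [].
have intfC := integrableS mD mC CD intf.
have intgC := integrableS mD mC CD intg.
have intfg : mu.-integrable C (f \- g) by exact: integrableB.
have : ae_eq mu C (f \- g) (cst 0).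
  apply/(ae_eq_integral_abs mu mC (measurable_int _ intfg)).
  apply/eqP; rewrite eq_le integral_ge0// andbT.
  rewrite (eq_integral (f \- g)); last first.
    by move=> x /set_mem[_ gf]; rewrite gee0_abs//; exact: subx_gt0.
  by have /= -> := integralB mC intfC intgC; rewrite sube_le0.
apply: filterS => x h Dx; rewrite leNgt; apply/negP => gf.
by have := subx_neq0 _ _ gf; rewrite (h (conj Dx gf)).
Qed.

(** Stated by preimages because the [G i] are bare families of sets on one and the same [Omega];
    [GmeasurableP] passes to the measurable type generated by [G]. *)
Definition Gmeasurable {T : Type} {R : realType} (G : set (set T)) (f : T -> \bar R) :=
  forall B, measurable B -> G (f @^-1` B).

Section sub_sigma_algebra.
Context {d : measure_display} {Omega : measurableType d} {R : realType}.
Variables (P : probability Omega R) (G : set (set Omega)).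
Hypotheses (sG : sigma_algebra setT G) (Gm : G `<=` measurable).
Implicit Types (f g : Omega -> \bar R) (A B : set Omega).

Local Notation GT := (g_sigma_algebraType G).

Lemma GmeasurableP f : Gmeasurable G f <-> measurable_fun [set: GT] f.
Proof.
have e : @measurable _ GT = G by exact: sigma_algebra_id.
split=> [h _ B mB|h B mB]; first by rewrite setTI e; exact: h.
by rewrite -e -[X in measurable X]setTI; exact: h.
Qed.

Lemma Gmeasurable_measurable f : Gmeasurable G f -> measurable_fun setT f.
Proof. by move=> h _ B mB; rewrite setTI; exact/Gm/h. Qed.

Lemma sub_sigmaT : G setT.
Proof. by case: sG => G0 GC _; rewrite -(setD0 setT); exact: GC. Qed.

Lemma sub_sigmaC A : G A -> G (~` A).
Proof. by case: sG => G0 GC _ GA; rewrite -setTD; exact: GC. Qed.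

Lemma sub_sigma_bigcup (F : (set Omega)^nat) : (forall i, G (F i)) -> G (\bigcup_i F i).
Proof. by case: sG => _ _; exact. Qed.

Lemma sub_sigmaU A B : G A -> G B -> G (A `|` B).
Proof.
move=> GA GB; rewrite -bigcup2E; apply: sub_sigma_bigcup => -[|[|i]]//=.
by case: sG.
Qed.

Lemma sub_sigmaI A B : G A -> G B -> G (A `&` B).
Proof.
by move=> GA GB; rewrite -(setCK (A `&` B)) setCI; apply/sub_sigmaC/sub_sigmaU;
  exact: sub_sigmaC.
Qed.

Lemma sub_sigma_bigcap (F : (set Omega)^nat) : (forall i, G (F i)) -> G (\bigcap_i F i).
Proof.
move=> GF; rewrite -(setCK (\bigcap_i F i)) setC_bigcap.
by apply/sub_sigmaC/sub_sigma_bigcup => i; exact/sub_sigmaC/GF.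
Qed.

Lemma sub_sigmaD A B : G A -> G B -> G (A `\` B).
Proof. by move=> GA GB; rewrite setDE; exact/sub_sigmaI/sub_sigmaC. Qed.

Lemma Gmeasurable_lt f g : Gmeasurable G f -> Gmeasurable G g ->
  G [set w | f w < g w].
Proof.
move=> /GmeasurableP mf /GmeasurableP mg.
have e : @measurable _ GT = G by exact: sigma_algebra_id.
by rewrite -e -[X in measurable X]setTI; exact: measurable_lte.
Qed.

Lemma Gmeasurable_le f g : Gmeasurable G f -> Gmeasurable G g ->
  G [set w | f w <= g w].
Proof.
move=> /GmeasurableP mf /GmeasurableP mg.
have e : @measurable _ GT = G by exact: sigma_algebra_id.
by rewrite -e -[X in measurable X]setTI; exact: measurable_lee.
Qed.

(** Radon-Nikodym on the type [GT]: a density found there is G-measurable by construction. *)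
Lemma condexp_ex f : P.-integrable setT f -> exists g, is_condexp P G f g.
Proof.
move=> intf.
have eG : @measurable _ GT = G by exact: sigma_algebra_id.
have mid : measurable_fun [set: Omega] (id : Omega -> GT).
  by move=> _ A mA; rewrite setTI; apply: Gm; rewrite -eG.
(* The identity, seen as a measurable map into the coarser space; the image of P under it is P
   restricted to G. *)
pose phi : {mfun Omega >-> GT} := HB.pack (id : Omega -> GT)
  (isMeasurableFun.Build _ _ _ _ (id : Omega -> GT) mid).
pose PG : probability GT R := distribution P phi.
pose nu0 : set GT -> \bar R := fun A => induced_charge intf A.
have nu00 : nu0 set0 = 0 by rewrite /nu0 /induced_charge integral_set0.
have nu0f (A : set GT) : measurable A -> nu0 A \is a fin_num.
  by rewrite eG => /Gm mA; exact: (fin_num_measure (induced_charge intf)).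
have nu0s : semi_sigma_additive nu0.
  move=> F mF tF mUF; apply: (@charge_semi_sigma_additive _ _ _ (induced_charge intf)) => //.
    by move=> i; apply: Gm; rewrite -eG.
  by apply: Gm; rewrite -eG.
pose nu : {charge set GT -> \bar R} := HB.pack nu0 (isCharge.Build _ _ _ nu0 nu00 nu0f nu0s).
have nuPG : nu `<< PG.
  apply/null_content_dominatesP => /= A mA PA0.
  apply: null_set_integral => //.
  - by apply: Gm; rewrite -eG.
  - exact: measurable_funTS (measurable_int _ intf).
pose g := Radon_Nikodym nu PG.
have gint : PG.-integrable setT g by exact: Radon_Nikodym_integrable.
have mg : measurable_fun [set: GT] g := measurable_int _ gint.
have mg' : measurable_fun [set: Omega] g.
  by apply: Gmeasurable_measurable; exact/GmeasurableP.
have gint' : P.-integrable setT g.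
  apply/integrableP; split => //.
  have /integrableP[_] := gint.
  by rewrite (ge0_integral_distribution phi)//; exact: measurableT_comp.
exists g; split => //; first exact/GmeasurableP.
move=> A GA.
have mA : @measurable _ GT A by rewrite eG.
transitivity (nu A) => //.
rewrite (Radon_Nikodym_integral nuPG mA) integral_pushforward//.
by apply: (integrableS measurableT) => //; exact: Gm.
Qed.

Local Notation E := (condexp P G).

Lemma condexpP f : P.-integrable setT f -> is_condexp P G f (E f).
Proof. by move=> intf; apply: xgetPex; exact: condexp_ex. Qed.

(** When no version exists, [condexp] is the constant 0, which is G-measurable and integrable
    too. *)
Lemma condexp_Gmeasurable f : Gmeasurable G (E f).
Proof.
rewrite /condexp; case: xgetP => [g -> []//|_ B mB].
by rewrite preimage_cst; case: ifPn => _; [exact: sub_sigmaT | case: sG].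
Qed.

Lemma condexp_integrable f : P.-integrable setT (E f).
Proof.
rewrite /condexp; case: xgetP => [g -> []//|_]; exact: integrable0.
Qed.

Lemma condexp_integral f A : P.-integrable setT f -> G A ->
  \int[P]_(w in A) E f w = \int[P]_(w in A) f w.
Proof. by move=> /condexpP[_ _]; exact. Qed.

(** The test event {g' < f'} may be cut down to B because B is in G. This locality allows a
    conditional expectation to be computed separately on each event {t = k}. *)
Lemma is_condexp_le_on B f g f' g' : G B ->
  P.-integrable setT f -> P.-integrable setT g ->
  is_condexp P G f f' -> is_condexp P G g g' ->
  {ae P, forall w, B w -> f w <= g w} -> {ae P, forall w, B w -> f' w <= g' w}.
Proof.
move=> GB intf intg [mf' intf' f'E] [mg' intg' g'E] fg.
have intS A h : G A -> P.-integrable setT h -> P.-integrable A h.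
  by move=> /Gm mA; exact: integrableS.
apply: integral_le_ae_le => //; try exact: intS; first exact: Gm.
have GC : G (B `&` [set x | g' x < f' x]) by apply: sub_sigmaI => //; exact: Gmeasurable_lt.
rewrite f'E// g'E//; apply: ae_le_integral; try exact: intS; first exact: Gm.
by apply: filterS fg => w h [Bw _]; exact: h.
Qed.

Lemma is_condexp_id f : Gmeasurable G f -> P.-integrable setT f -> is_condexp P G f f.
Proof. by move=> mf intf; split. Qed.

Lemma condexp_le_on B f g : G B ->
  P.-integrable setT f -> P.-integrable setT g ->
  {ae P, forall w, B w -> f w <= g w} -> {ae P, forall w, B w -> E f w <= E g w}.
Proof. by move=> GB intf intg; apply: is_condexp_le_on => //; exact: condexpP. Qed.

Lemma condexp_eq_on B f g : G B ->
  P.-integrable setT f -> P.-integrable setT g ->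
  {ae P, forall w, B w -> f w = g w} -> {ae P, forall w, B w -> E f w = E g w}.
Proof.
move=> GB intf intg fg.
have h1 : {ae P, forall w, B w -> E f w <= E g w}.
  by apply: condexp_le_on => //; apply: filterS fg => w h Bw; rewrite h.
have h2 : {ae P, forall w, B w -> E g w <= E f w}.
  by apply: condexp_le_on => //; apply: filterS fg => w h Bw; rewrite h.
by apply: filterS2 h1 h2 => w h1 h2 Bw; apply/eqP; rewrite eq_le h1// h2.
Qed.

Lemma condexp_le f g : P.-integrable setT f -> P.-integrable setT g ->
  {ae P, forall w, f w <= g w} -> {ae P, forall w, E f w <= E g w}.
Proof.
move=> intf intg fg.
have fgT : {ae P, forall w, setT w -> f w <= g w} by apply: filterS fg.
by apply: filterS (condexp_le_on sub_sigmaT intf intg fgT) => w; exact.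
Qed.

Lemma condexp_eq f g : P.-integrable setT f -> P.-integrable setT g ->
  {ae P, forall w, f w = g w} -> {ae P, forall w, E f w = E g w}.
Proof.
move=> intf intg fg.
have fgT : {ae P, forall w, setT w -> f w = g w} by apply: filterS fg.
by apply: filterS (condexp_eq_on sub_sigmaT intf intg fgT) => w; exact.
Qed.

Lemma is_condexp_uniq f g g' : P.-integrable setT f ->
  is_condexp P G f g -> is_condexp P G f g' -> {ae P, forall w, g w = g' w}.
Proof.
move=> intf h h'.
have ff : {ae P, forall w, setT w -> f w <= f w} by exact: aeW.
have h1 := is_condexp_le_on sub_sigmaT intf intf h h' ff.
have h2 := is_condexp_le_on sub_sigmaT intf intf h' h ff.
by apply: filterS2 h1 h2 => w h1 h2; apply/eqP; rewrite eq_le h1// h2.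
Qed.

Lemma condexp_id f : Gmeasurable G f -> P.-integrable setT f ->
  {ae P, forall w, E f w = f w}.
Proof.
move=> mf intf; apply: (is_condexp_uniq intf); first exact: condexpP.
exact: is_condexp_id.
Qed.

Lemma Gmeasurable_ereal_sup (S : set nat) (f_ : nat -> Omega -> \bar R) :
  (forall k, S k -> Gmeasurable G (f_ k)) ->
  Gmeasurable G (fun w => ereal_sup [set f_ k w | k in S]).
Proof.
move=> mf; apply/GmeasurableP => _.
apply: (measurability _ (ErealGenOInfty.measurableE R)) => //.
move=> _ [_ [x ->] <-]; rewrite setTI.
have -> : (fun w => ereal_sup [set f_ k w | k in S]) @^-1` `]x%:E, +oo[ =
    \bigcup_(k in S) f_ k @^-1` `]x%:E, +oo[.
  apply/seteqP; split => w /=; rewrite in_itv/= andbT.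
    move=> /ereal_sup_gt[_ [k Sk <-] xf]; exists k => //=.
    by rewrite in_itv/= xf.
  move=> [k Sk] /=; rewrite in_itv/= andbT => /lt_le_trans; apply.
  by apply: ereal_sup_ubound; exists k.
apply: bigcup_measurable => k Sk.
have /GmeasurableP mfk := mf k Sk.
by rewrite -[X in measurable X]setTI; apply: mfk => //; exact: emeasurable_itv.
Qed.

Lemma condexp_ge0 f : P.-integrable setT f -> {ae P, forall w, 0 <= f w} ->
  {ae P, forall w, 0 <= E f w}.
Proof.
move=> intf f0; have int0 : P.-integrable setT (cst 0 : Omega -> \bar R) by exact: integrable0.
have m0 : Gmeasurable G (cst 0 : Omega -> \bar R) by apply/GmeasurableP; exact: measurable_cst.
by apply: filterS2 (condexp_id m0 int0) (condexp_le int0 intf f0) => w -> .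
Qed.

(** * Limits of conditional expectations under domination *)

Section dominated.
Variables (f_ : nat -> Omega -> \bar R) (f M : Omega -> \bar R).
Hypotheses (mf_ : forall n, measurable_fun setT (f_ n)) (mf : measurable_fun setT f).
Hypotheses (f_f : {ae P, forall w, f_ n w @[n --> \oo] --> f w}).
Hypotheses (intM : P.-integrable setT M).
Hypotheses (f_M : {ae P, forall w n, `|f_ n w| <= M w}).

Let integrable_f_ n : P.-integrable setT (f_ n).
Proof.
apply: (ae_le_integrable measurableT (mf_ n) _ intM).
by apply: filterS f_M => w /(_ n) h _; apply: le_trans h _; exact: lee_abs.
Qed.

Let cvg_int A : measurable A ->
  P.-integrable A f /\
  \int[P]_(w in A) f_ n w @[n --> \oo] --> \int[P]_(w in A) f w.
Proof.
move=> mA.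
have [intf _ h] : [/\ P.-integrable A f,
    [sequence \int[P]_(x in A) `|f_ n x - f x|]_n @ \oo --> 0 &
    [sequence \int[P]_(x in A) f_ n x]_n @ \oo --> \int[P]_(x in A) f x].
  apply: (dominated_convergence mA (g := M)).
  - by move=> n; exact: measurable_funTS.
  - exact: measurable_funTS.
  - by apply: filterS f_f => w h _.
  - exact: integrableS intM.
  - by apply: filterS f_M => w h n _.
by [].
Qed.

Let integrable_f : P.-integrable setT f.
Proof. by have [] := cvg_int measurableT. Qed.

(** On C = {E f < h}, an event of G, dominated convergence gives that the integral of E f is the
    limit of the integrals of E (f_ n), hence at least that of h. Almost sure convergence of E (f_
    n) is thereby avoided. *)
Lemma condexp_lim_ge h : Gmeasurable G h -> P.-integrable setT h ->
  (\forall n \near \oo, {ae P, forall w, h w <= E (f_ n) w}) -> {ae P, forall w, h w <= E f w}.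
Proof.
move=> mh inth hf.
suff : {ae P, forall w, setT w -> h w <= E f w} by apply: filterS => w; exact.
have GC : G (setT `&` [set x | E f x < h x]).
  by rewrite setTI; apply: Gmeasurable_lt => //; exact: condexp_Gmeasurable.
have intS A g : G A -> P.-integrable setT g -> P.-integrable A g.
  by move=> /Gm mA; exact: integrableS.
apply: integral_le_ae_le => //; first exact: condexp_integrable.
rewrite condexp_integral//.
have [_ cvgf] := cvg_int (Gm GC).
rewrite -(cvg_lim _ cvgf)//; apply: lime_ge; first by apply/cvg_ex; eexists; exact: cvgf.
apply: filterS hf => n hf; rewrite -condexp_integral//.
apply: ae_le_integral; [exact: Gm|exact: intS| |].
  by apply: intS => //; exact: condexp_integrable.
by apply: filterS hf.
Qed.

Lemma condexp_lim_le h : Gmeasurable G h -> P.-integrable setT h ->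
  (\forall n \near \oo, {ae P, forall w, E (f_ n) w <= h w}) -> {ae P, forall w, E f w <= h w}.
Proof.
move=> mh inth hf.
suff : {ae P, forall w, setT w -> E f w <= h w} by apply: filterS => w; exact.
have GC : G (setT `&` [set x | h x < E f x]).
  by rewrite setTI; apply: Gmeasurable_lt => //; exact: condexp_Gmeasurable.
have intS A g : G A -> P.-integrable setT g -> P.-integrable A g.
  by move=> /Gm mA; exact: integrableS.
apply: integral_le_ae_le => //; first exact: condexp_integrable.
rewrite condexp_integral//.
have [_ cvgf] := cvg_int (Gm GC).
rewrite -(cvg_lim _ cvgf)//; apply: lime_le; first by apply/cvg_ex; eexists; exact: cvgf.
apply: filterS hf => n hf; rewrite -condexp_integral//.
apply: ae_le_integral; [exact: Gm| |exact: intS|].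
  by apply: intS => //; exact: condexp_integrable.
by apply: filterS hf.
Qed.

Hypothesis E_nd : forall n, {ae P, forall w, E (f_ n) w <= E (f_ n.+1) w}.

Let ae_E_nd : {ae P, forall w, nondecreasing_seq (fun n => E (f_ n) w)}.
Proof. by apply: filterS (ae_foralln E_nd) => w /nondecreasing_seqP. Qed.

Lemma condexp_monotone_le n : {ae P, forall w, E (f_ n) w <= E f w}.
Proof.
apply: condexp_lim_ge; first exact: condexp_Gmeasurable.
  exact: condexp_integrable.
by exists n => // m /= nm; apply: filterS ae_E_nd => w; exact.
Qed.

(** The sequence [f_] itself need not be monotone, so the supremum W of the E (f_ n) is compared
    with E f from both sides: W <= E f term by term, and E f <= W by [condexp_lim_le] with h = W. *)
Lemma condexp_monotone_cvg : {ae P, forall w, E (f_ n) w @[n --> \oo] --> E f w}.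
Proof.
pose W w := ereal_sup (range (fun n => E (f_ n) w)).
have leEf : {ae P, forall w, forall n, E (f_ n) w <= E f w}.
  exact: (ae_foralln condexp_monotone_le).
have mW : Gmeasurable G W.
  by apply: Gmeasurable_ereal_sup => k _; exact: condexp_Gmeasurable.
have leW n w : E (f_ n) w <= W w by apply: ereal_sup_ubound; exists n.
have Wle : {ae P, forall w, W w <= E f w}.
  by apply: filterS leEf => w h; apply: ge_ereal_sup => _ [n _ <-].
(* W lies between E (f_ 0) and E f, so the sum of their absolute values bounds it. *)
have intW : P.-integrable setT W.
  apply: (@ae_le_integrable _ _ _ P setT measurableT W
      (fun w => `|E (f_ 0) w| + `|E f w|)).
  - exact: Gmeasurable_measurable.
  - apply: filterS Wle => w WE _; rewrite [leRHS]gee0_abs ?adde_ge0//.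
    have [W0|/ltW W0] := leP 0 (W w).
      by rewrite gee0_abs//; apply: (le_trans WE); apply: (le_trans (lee_abs _)); exact: leeDr.
    rewrite lee0_abs//; apply: (@le_trans _ _ `|E (f_ 0) w|); last exact: leeDl.
    by rewrite -abseN; apply: le_trans (lee_abs _); rewrite leeN2.
  - by apply: integrableD => //; apply: integrable_abse; exact: condexp_integrable.
have Ele : {ae P, forall w, E f w <= W w}.
  by apply: condexp_lim_le => //; apply: nearW => n; exact: aeW.
apply: filterS3 ae_E_nd Wle Ele => w nd h1 h2.
have -> : E f w = W w by apply/eqP; rewrite eq_le h1 h2.
exact: ereal_nondecreasing_cvgn.
Qed.

End dominated.

Lemma Gmeasurable_cover (C : (set Omega)^nat) (f_ : nat -> Omega -> \bar R) f :
  (forall k, G (C k)) -> (forall k, Gmeasurable G (f_ k)) ->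
  (forall w, exists k, C k w) -> (forall k w, C k w -> f w = f_ k w) ->
  Gmeasurable G f.
Proof.
move=> GC mf cov fE B mB.
have -> : f @^-1` B = \bigcup_k (C k `&` f_ k @^-1` B).
  apply/seteqP; split => [w Bf|w [k _ [Ck /=]]]; last by rewrite -(fE k).
  by have [k Ck] := cov w; exists k => //; split => //=; rewrite -(fE k).
by apply: sub_sigma_bigcup => k; apply: sub_sigmaI => //; exact: mf.
Qed.

Hypothesis Gnull : forall A, P.-negligible A -> G A.

(** A' agrees with A off a null event, and what remains of A' inside that event is negligible, hence
    in G. *)
Lemma sub_sigma_ae A A' : G A -> {ae P, forall w, A w <-> A' w} -> G A'.
Proof.
move=> GA AA'; have -> : A' = (A `&` [set w | A w <-> A' w]) `|`
    (A' `&` ~` [set w | A w <-> A' w]).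
  apply/seteqP; split => w /=; last by move=> [[Aw h]|[]//]; apply/h.
  by move=> A'w; have [e|e] := pselect (A w <-> A' w); [left; split=> //; apply/e|right].
apply: sub_sigmaU; last by apply: Gnull; apply: negligibleS AA' => w [].
apply: sub_sigmaI => //; rewrite -[X in G X]setCK; exact/sub_sigmaC/Gnull.
Qed.

Lemma Gmeasurable_ae f g : {ae P, forall w, f w = g w} ->
  Gmeasurable G f -> Gmeasurable G g.
Proof.
move=> fg mf B mB; apply: (sub_sigma_ae (mf B mB)).
by apply: filterS fg => w /= ->.
Qed.

(** The upper limit is G-measurable everywhere and agrees with f almost surely. *)
Lemma Gmeasurable_cvg (f_ : nat -> Omega -> \bar R) f :
  (forall n, Gmeasurable G (f_ n)) ->
  {ae P, forall w, f_ n w @[n --> \oo] --> f w} -> Gmeasurable G f.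
Proof.
move=> mf cvgf.
apply: (@Gmeasurable_ae (fun w => limn_esup (f_ ^~ w))).
  apply: filterS cvgf => w h.
  by rewrite limn_esup_lim; apply/cvg_lim => //; exact: cvg_esups.
apply/GmeasurableP; apply: measurable_fun_limn_esup => n; exact/GmeasurableP.
Qed.

End sub_sigma_algebra.

Section tower.
Context {d : measure_display} {Omega : measurableType d} {R : realType}.
Variables (P : probability Omega R) (G H : set (set Omega)).
Hypotheses (sG : sigma_algebra setT G) (Gm : G `<=` measurable).
Hypotheses (sH : sigma_algebra setT H) (Hm : H `<=` measurable).
Hypotheses (GH : G `<=` H).

Lemma condexp_tower f : P.-integrable setT f ->
  {ae P, forall w, condexp P G (condexp P H f) w = condexp P G f w}.
Proof.
move=> intf; apply: (is_condexp_uniq sG Gm intf); last exact: condexpP.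
split; [exact: condexp_Gmeasurable|exact: condexp_integrable|].
move=> A GA; rewrite condexp_integral//; last exact: condexp_integrable.
by rewrite condexp_integral//; exact: GH.
Qed.

End tower.

(** * Policy iteration in discrete time *)

Section first_from.
Context {R : realType}.
Implicit Types (S : nat -> Prop) (i j k n : nat).

Lemma lee_nat m n : (m%:R%:E <= n%:R%:E :> \bar R) = (m <= n)%N.
Proof. by rewrite lee_fin ler_nat. Qed.

Lemma lte_nat m n : (m%:R%:E < n%:R%:E :> \bar R) = (m < n)%N.
Proof. by rewrite lte_fin ltr_nat. Qed.

Lemma nat_EFin_inj m n : m%:R%:E = n%:R%:E :> \bar R -> m = n.
Proof. by case=> /eqP; rewrite eqr_nat => /eqP. Qed.

Local Notation ff := (@first_from R).

Lemma first_from_le i S k : (i <= k)%N -> S k -> ff i S <= k%:R%:E.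
Proof. by move=> ik Sk; apply: ereal_inf_lbound; exists k. Qed.

Lemma first_from_ge i S : i%:R%:E <= ff i S.
Proof. by apply: le_ereal_inf_tmp => _ [j [ij _] <-]; rewrite lee_nat. Qed.

Lemma first_fromP i S :
  (ff i S = +oo /\ forall j, (i <= j)%N -> ~ S j) \/
  exists k, [/\ ff i S = k%:R%:E, (i <= k)%N, S k &
                forall j, (i <= j)%N -> (j < k)%N -> ~ S j].
Proof.
have [[k0 [ik0 Sk0]]|nS] := pselect (exists k, (i <= k)%N /\ S k); last first.
  left; split; last by move=> j ij Sj; apply: nS; exists j.
  rewrite /first_from (_ : [set _ | _] = set0) ?image_set0 ?ereal_inf0//.
  by rewrite -subset0 => j [ij Sj]; apply: nS; exists j.
have exk : exists k, (i <= k)%N && `[< S k >] by exists k0; rewrite ik0; apply/asboolP.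
right; case: (ex_minnP exk) => k /andP[ik /asboolP Sk] kmin.
have kmin' j : (i <= j)%N -> S j -> (k <= j)%N.
  by move=> ij Sj; apply: kmin; rewrite ij; apply/asboolP.
exists k; split => //.
  apply/eqP; rewrite eq_le first_from_le//=.
  by apply: le_ereal_inf_tmp => _ [j [ij Sj] <-]; rewrite lee_nat; exact: kmin'.
by move=> j ij jk Sj; have := kmin' _ ij Sj; rewrite leqNgt jk.
Qed.

Lemma first_from_leP i S n :
  ff i S <= n%:R%:E <-> exists j, [/\ (i <= j)%N, (j <= n)%N & S j].
Proof.
split=> [|[j [ij jn Sj]]]; last first.
  by apply: (le_trans (first_from_le ij Sj)); rewrite lee_nat.
case: (first_fromP i S) => [[-> _]//|[k [-> ik Sk _]]].
by rewrite lee_nat => kn; exists k.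
Qed.

Lemma first_from_value i S :
  ff i S = +oo \/ exists k : nat, ff i S = k%:R%:E.
Proof. by case: (first_fromP i S) => [[? _]|[k [? _ _ _]]]; [left|right; exists k]. Qed.

Lemma first_from_here i S : S i -> ff i S = i%:R%:E.
Proof. by move=> Si; apply/eqP; rewrite eq_le first_from_ge first_from_le. Qed.

Lemma first_from_succ i S : ~ S i -> ff i S = ff i.+1 S.
Proof.
move=> nSi; rewrite /first_from; congr (ereal_inf _).
apply/seteqP; split => _ [j [ij Sj] <-]; exists j => //; split => //; last exact: ltnW.
by rewrite ltn_neqAle ij andbT; apply/eqP => e; apply: nSi; rewrite e.
Qed.

Lemma first_from_neq i S j : (i <= j)%N -> j%:R%:E < ff i S -> ~ S j.
Proof.
by move=> ij jf Sj; have := lt_le_trans jf (first_from_le ij Sj); rewrite ltxx.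
Qed.

Lemma first_from_sub i S S' : (forall j, S j -> S' j) -> ff i S' <= ff i S.
Proof.
move=> SS'; case: (first_fromP i S) => [[-> _]|[k [-> ik /SS' Sk _]]]; first exact: leey.
exact: first_from_le.
Qed.

Lemma eq_first_from i S S' : (forall j, (i <= j)%N -> S j <-> S' j) -> ff i S = ff i S'.
Proof.
move=> SS'; rewrite /first_from; congr (ereal_inf _).
by apply/seteqP; split => _ [j [ij Sj] <-]; exists j => //; split => //; apply/SS'.
Qed.

End first_from.

Lemma window_self kappa j : window kappa j j.
Proof. by split=> //; case: kappa => // K; exact: leq_addr. Qed.

(** This is where kappa >= 1 enters: every update compares stopping at j with the policy started at
    j + 1. *)
Lemma window_next kappa j : kappa <> Some 0%N -> window kappa j j.+1.
Proof. by move=> k0; split=> //; case: kappa k0 => // -[//|K] _; rewrite addnS ltnS leq_addr. Qed.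

Lemma window_succ kappa j k : (j < k)%N -> window kappa j k -> window kappa j.+1 k.
Proof.
by move=> jk [_ h]; split=> //; case: kappa h => // K /leq_trans; apply; rewrite leq_add2r.
Qed.

Lemma near_ltn (k : nat) (Q : nat -> nat -> Prop) :
  (forall j, (j < k)%N -> \forall m \near \oo, Q j m) ->
  \forall m \near \oo, forall j, (j < k)%N -> Q j m.
Proof.
elim: k => [|k IH] h; first exact: nearW.
have h1 : \forall m \near \oo, forall j, (j < k)%N -> Q j m.
  by apply: IH => j jk; apply: h; exact: leqW.
apply: filterS2 h1 (h k (leqnn _)) => m h1 h2 j.
by rewrite ltnS leq_eqVlt => /orP[/eqP ->//|]; exact: h1.
Qed.

(** * A discrete-time stopping problem whose rewards have an integrable supremum *)

Section discrete.
Context {d : measure_display} {Omega : measurableType d} {R : realType}.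
Variables (P : probability Omega R) (G : nat -> set (set Omega)).
Variables (U : nat -> Omega -> \bar R) (K : nat -> set Omega).
Hypotheses (sG : forall i, sigma_algebra setT (G i)).
Hypotheses (Gm : forall i, G i `<=` measurable).
Hypotheses (Gmono : forall i j, (i <= j)%N -> G i `<=` G j).
Hypotheses (Gnull : forall i A, P.-negligible A -> G i A).
Hypotheses (U0 : forall i w, 0 <= U i w).
Hypotheses (mU : forall i, Gmeasurable (G i) (U i)).

Let M w := ereal_sup (range (U ^~ w)).

Hypotheses (intM : P.-integrable setT M).
(** Abstract form of the finite horizon: on [K i], which is known at time i, all rewards from i on
    vanish, and almost surely [K i] holds eventually. In the application [K i] is the event {T <
    tau_i}. *)
Hypotheses (GK : forall i, G i (K i)).
Hypotheses (UK : forall i k, (i <= k)%N -> {ae P, forall w, K i w -> U k w = 0}).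
Hypotheses (evK : {ae P, forall w, \forall i \near \oo, K i w}).

Local Notation E i := (condexp P (G i)).
Local Notation stopping := (discrete_stopping_time G).
Implicit Types (t : Omega -> \bar R) (w : Omega).

Lemma stopping_value t : stopping t -> forall w, t w = +oo \/ exists k : nat, t w = k%:R%:E.
Proof. by case. Qed.

Lemma stopping_le t k : stopping t -> G k [set w | t w <= k%:R%:E].
Proof. by case. Qed.

Lemma stopping_gt t k : stopping t -> G k [set w | k%:R%:E < t w].
Proof.
move=> st; have -> : [set w | k%:R%:E < t w] = ~` [set w | t w <= k%:R%:E].
  by apply/seteqP; split => w /=; rewrite ltNge => /negP.
by apply: (sub_sigmaC (sG k)); exact: stopping_le.
Qed.

(** {n <= t} is the complement of {t <= n - 1}, so it is known one step early. The case n = m + 1 is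
    what the one-step inequalities need. *)
Lemma stopping_ge t n m : stopping t -> (n <= m.+1)%N -> G m [set w | n%:R%:E <= t w].
Proof.
move=> st; case: n => [_|n nm].
  have -> : [set w | 0%:R%:E <= t w] = setT.
    rewrite -subTset => w _ /=.
    by case: (stopping_value st w) => [->|[k ->]]; rewrite ?leey// lee_nat.
  exact: sub_sigmaT.
have -> : [set w | n.+1%:R%:E <= t w] = [set w | n%:R%:E < t w].
  apply/seteqP; split => w /=;
    by case: (stopping_value st w) => [->|[k ->]]; rewrite ?leey ?ltry// lee_nat lte_nat.
by apply: (Gmono (nm : (n <= m)%N)); exact: stopping_gt.
Qed.

Lemma stopping_eq t k m : stopping t -> (k <= m)%N -> G m [set w | t w = k%:R%:E].
Proof.
move=> st km; have -> : [set w | t w = k%:R%:E] =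
    [set w | t w <= k%:R%:E] `&` [set w | k%:R%:E <= t w].
  apply/seteqP; split => w /=; first by move=> ->.
  by case=> h1 h2; apply/eqP; rewrite eq_le h1.
apply: (Gmono km); apply: (sub_sigmaI (sG k)); first exact: stopping_le.
exact: stopping_ge.
Qed.

Lemma stopping_first_from i (S : nat -> set Omega) :
  (forall j, G j (S j)) -> stopping (fun w => first_from i (fun j => S j w) : \bar R).
Proof.
move=> GS; split=> [w|n]; first exact: first_from_value.
have -> : [set w | first_from i (fun j => S j w) <= n%:R%:E :> \bar R] =
    \bigcup_(j in [set j | (i <= j)%N /\ (j <= n)%N]) S j.
  apply/seteqP; split => w /=; first by move=> /first_from_leP[j [ij jn Sj]]; exists j.
  by move=> [j [ij jn] Sj]; apply/first_from_leP; exists j.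
rewrite bigcup_mkcond; apply: (sub_sigma_bigcup (sG n)) => j.
case: ifPn => [/set_mem[ij jn]|_]; first exact: (Gmono jn).
by case: (sG n).
Qed.

Lemma stopped_ge0 t w : 0 <= stopped U t w.
Proof. by rewrite /stopped; case: (t w) => [r||]. Qed.

Lemma U_le_sup k w : U k w <= M w.
Proof. by apply: ereal_sup_ubound; exists k. Qed.

Lemma sup_ge0 w : 0 <= M w.
Proof. exact: le_trans (U0 0 w) (U_le_sup 0 w). Qed.

Lemma stopped_le_sup t w : stopped U t w <= M w.
Proof. by rewrite /stopped; case: (t w) => [r||]; rewrite ?U_le_sup ?sup_ge0. Qed.

Lemma U_measurable k : measurable_fun setT (U k).
Proof. exact: Gmeasurable_measurable (mU k). Qed.

Lemma U_integrable k : P.-integrable setT (U k).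
Proof.
apply: (le_integrable measurableT (U_measurable k) _ intM) => w _.
by rewrite !gee0_abs ?sup_ge0// U_le_sup.
Qed.

Lemma E_U k m : (k <= m)%N -> {ae P, forall w, E m (U k) w = U k w}.
Proof.
move=> km; apply: condexp_id => //; last exact: U_integrable.
by move=> B mB; apply: (Gmono km); exact: mU.
Qed.

Lemma stoppedE t w k : t w = k%:R%:E -> stopped U t w = U k w.
Proof. by rewrite /stopped => ->; rewrite natrK. Qed.

(** * Stopping times truncated at a deterministic index *)

Section stopped_or.
Variables (t : Omega -> \bar R) (st : stopping t).

(** Payoff of following t before time n and receiving W if t has not stopped by then; t = +oo counts
    as not having stopped. With W = L n or W = V n, one-step inequalities for L or V become one-step
    inequalities for these payoffs. *)
Definition stopped_or (n : nat) (W : Omega -> \bar R) (w : Omega) : \bar R :=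
  if t w < n%:R%:E then stopped U t w else W w.

Lemma stopped_orE n W w k : (k < n)%N -> t w = k%:R%:E -> stopped_or n W w = U k w.
Proof. by move=> kn e; rewrite /stopped_or (stoppedE e) e lte_nat kn. Qed.

Lemma stopped_or_ge n W w : n%:R%:E <= t w -> stopped_or n W w = W w.
Proof. by move=> h; rewrite /stopped_or ltNge h. Qed.

Lemma stopped_or_measurable n W : measurable_fun setT W ->
  measurable_fun setT (stopped_or n W).
Proof.
move=> mW _ B mB; rewrite setTI.
have -> : stopped_or n W @^-1` B =
    (\bigcup_(k in [set k | (k < n)%N]) ([set w | t w = k%:R%:E] `&` U k @^-1` B)) `|`
    ([set w | n%:R%:E <= t w] `&` W @^-1` B).
  apply/seteqP; split => w /=.
    have [h|h] := leP n%:R%:E (t w); first by rewrite stopped_or_ge//; right.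
    case: (stopping_value st w) => [e|[k e]]; first by rewrite e in h.
    move: (h); rewrite e lte_nat => kn; rewrite (stopped_orE _ kn e) => BU.
    by left; exists k.
  by move=> [[k kn [e]]|[h]]; [rewrite (stopped_orE _ kn e)|rewrite stopped_or_ge].
apply: measurableU.
  apply: bigcup_measurable => k _; apply: measurableI.
    by apply: (@Gm k); exact: stopping_eq.
  by rewrite -[X in measurable X]setTI; exact: U_measurable.
apply: measurableI; first by apply: (@Gm n); exact: stopping_ge.
by rewrite -[X in measurable X]setTI; exact: mW.
Qed.

Lemma stopped_or_integrable n W : P.-integrable setT W ->
  P.-integrable setT (stopped_or n W).
Proof.
move=> intW.
have intMW : P.-integrable setT (fun w => M w + `|W w|).
  by apply: integrableD => //; exact: integrable_abse.
apply: (le_integrable measurableT _ _ intMW).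
  by apply: stopped_or_measurable; exact: measurable_int intW.
move=> w _; rewrite [leRHS]gee0_abs ?adde_ge0 ?sup_ge0//.
rewrite /stopped_or; case: ifP => _; last by rewrite leeDr// sup_ge0.
by rewrite gee0_abs ?stopped_ge0// (le_trans (stopped_le_sup _ _))// leeDl.
Qed.

(* On {t < n} the random variable is already G_m-measurable, on {n <= t}, which is
   an event of G_m, it is W. *)
Lemma condexp_stopped_or n m W : (n <= m.+1)%N -> P.-integrable setT W ->
  {ae P, forall w, E m (stopped_or n W) w = stopped_or n (E m W) w}.
Proof.
move=> nm intW.
have intS := stopped_or_integrable n intW.
have h1 : {ae P, forall w, forall k, (k < n)%N -> t w = k%:R%:E ->
    E m (stopped_or n W) w = U k w}.
  apply: ae_foralln => k.
  have [kn|kn] := boolP (k < n)%N; last exact: aeW.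
  have km : (k <= m)%N by rewrite -ltnS (leq_trans kn).
  have h : {ae P, forall w, t w = k%:R%:E -> E m (stopped_or n W) w = E m (U k) w}.
    apply: (condexp_eq_on (sG m) (@Gm m) (stopping_eq st km) intS (U_integrable k)).
    by apply: aeW => w e; rewrite (stopped_orE _ kn e).
  by apply: filterS2 h (E_U km) => w h <- _.
have h2 : {ae P, forall w, n%:R%:E <= t w -> E m (stopped_or n W) w = E m W w}.
  apply: (condexp_eq_on (sG m) (@Gm m) (stopping_ge st nm)) => //.
  by apply: aeW => w h; rewrite stopped_or_ge.
apply: filterS2 h1 h2 => w h1 h2.
have [h|h] := leP n%:R%:E (t w); first by rewrite h2// stopped_or_ge.
case: (stopping_value st w) => [e|[k e]]; first by rewrite e in h.
by move: h; rewrite e lte_nat => kn; rewrite (h1 k)// (stopped_orE _ kn e).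
Qed.

Lemma stopped_or_cvg W w : t w < +oo ->
  stopped_or n W w @[n --> \oo] --> stopped U t w.
Proof.
case: (stopping_value st w) => [->//|[k e] _]; apply: cvg_near_cst.
by exists k.+1 => // n /= kn; rewrite (stopped_orE _ kn e) (stoppedE e).
Qed.

Lemma stopped_measurable : measurable_fun setT (stopped U t).
Proof.
(* The continuation payoff 0 matches the value of [stopped] at t = +oo, so the truncations converge
   at every w. *)
apply: (emeasurable_fun_cvg (fun n => stopped_or n (cst 0))) => [n|w _].
  exact/stopped_or_measurable/measurable_cst.
case: (stopping_value st w) => [e|[k e]]; last by apply: stopped_or_cvg; rewrite e ltry.
by apply: cvg_near_cst; apply: nearW => n; rewrite /stopped_or /stopped e.
Qed.

Lemma stopped_integrable : P.-integrable setT (stopped U t).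
Proof.
apply: (le_integrable measurableT stopped_measurable _ intM) => w _.
by rewrite !gee0_abs ?sup_ge0 ?stopped_ge0// stopped_le_sup.
Qed.

End stopped_or.

(** The one-step inequalities are chained by the tower property. G_n-measurability of [g n] is not
    part of the data, hence [E i (g i)] rather than [g i] on the left. *)
Lemma condexp_chain_le i (g : nat -> Omega -> \bar R) :
  (forall n, P.-integrable setT (g n)) ->
  (forall n, (i <= n)%N -> {ae P, forall w, g n w <= E n (g n.+1) w}) ->
  forall n, (i <= n)%N -> {ae P, forall w, E i (g i) w <= E i (g n) w}.
Proof.
move=> intg gE; elim=> [|n IH].
  by rewrite leqn0 => /eqP ->; exact: aeW.
rewrite leq_eqVlt => /orP[/eqP ->|]; first exact: aeW.
rewrite ltnS => le_in.
have h : {ae P, forall w, E i (g n) w <= E i (E n (g n.+1)) w}.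
  by apply: condexp_le => //; [exact: condexp_integrable|exact: gE].
have h' := condexp_tower (sG i) (@Gm i) (sG n) (@Gm n) (Gmono le_in) (intg n.+1).
by apply: filterS3 (IH le_in) h h' => w h1 h2 <-; exact: le_trans h2.
Qed.

Lemma condexp_chain_ge i (g : nat -> Omega -> \bar R) :
  (forall n, P.-integrable setT (g n)) ->
  (forall n, (i <= n)%N -> {ae P, forall w, E n (g n.+1) w <= g n w}) ->
  forall n, (i <= n)%N -> {ae P, forall w, E i (g n) w <= E i (g i) w}.
Proof.
move=> intg gE; elim=> [|n IH].
  by rewrite leqn0 => /eqP ->; exact: aeW.
rewrite leq_eqVlt => /orP[/eqP ->|]; first exact: aeW.
rewrite ltnS => le_in.
have h : {ae P, forall w, E i (E n (g n.+1)) w <= E i (g n) w}.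
  by apply: condexp_le => //; [exact: condexp_integrable|exact: gE].
have h' := condexp_tower (sG i) (@Gm i) (sG n) (@Gm n) (Gmono le_in) (intg n.+1).
by apply: filterS3 (IH le_in) h h' => w h1 h2 <-; exact: le_trans h1.
Qed.

Lemma ae_first_from_lty (S : nat -> Omega -> Prop) :
  (forall j, {ae P, forall w, K j w -> S j w}) ->
  {ae P, forall w, forall i, first_from i (S ^~ w) < +oo :> \bar R}.
Proof.
move=> KS; apply: filterS2 (ae_foralln KS) evK => w {}KS [N _ KN] i.
apply: (@le_lt_trans _ _ (maxn i N)%:R%:E); last exact: ltry.
by apply: first_from_le; [exact: leq_maxl|apply/KS/KN; exact: leq_maxr].
Qed.

(** * One update of a consistent family *)

Section one_policy.
Variables (kappa : option nat) (hkappa : kappa <> Some 0%N).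
Variables (sigma : nat -> Omega -> \bar R).
Hypothesis csigma : consistent_family P G sigma.

Let L := lookahead P G U kappa sigma.

Lemma consistent_stopping k : stopping (sigma k).
Proof. by case: csigma. Qed.

Lemma consistent_ge k : {ae P, forall w, k%:R%:E <= sigma k w}.
Proof. by case: csigma => _ /(_ k) + _; apply: filterS => w []. Qed.

Lemma consistent_eq k : {ae P, forall w, k%:R%:E < sigma k w -> sigma k w = sigma k.+1 w}.
Proof. by case: csigma. Qed.

Let stX k : P.-integrable setT (stopped U (sigma k)).
Proof. by apply: stopped_integrable; exact: consistent_stopping. Qed.

Lemma lookahead_Gmeasurable j : Gmeasurable (G j) (L j).
Proof. by apply: Gmeasurable_ereal_sup => // k _; exact: condexp_Gmeasurable. Qed.

Lemma lookahead_ub j k w : window kappa j k -> E j (stopped U (sigma k)) w <= L j w.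
Proof. by move=> jk; apply: ereal_sup_ubound; exists k. Qed.

Lemma lookahead_lub j w x :
  (forall k, window kappa j k -> E j (stopped U (sigma k)) w <= x) -> L j w <= x.
Proof. by move=> h; apply: ge_ereal_sup => _ [k jk <-]; exact: h. Qed.

Lemma lookahead_ge0 j : {ae P, forall w, 0 <= L j w}.
Proof.
have h : {ae P, forall w, 0 <= E j (stopped U (sigma j)) w}.
  by apply: condexp_ge0 => //; apply: aeW => w; exact: stopped_ge0.
by apply: filterS h => w h; apply: (le_trans h); apply: lookahead_ub; exact: window_self.
Qed.

(** A bound uniform over the window, so that L stays integrable for kappa = infinity. *)
Lemma lookahead_le_sup j : {ae P, forall w, L j w <= E j M w}.
Proof.
have h k : {ae P, forall w, E j (stopped U (sigma k)) w <= E j M w}.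
  by apply: condexp_le => //; apply: aeW => w; exact: stopped_le_sup.
by apply: filterS (ae_foralln h) => w h'; apply: lookahead_lub => k _.
Qed.

Lemma lookahead_integrable j : P.-integrable setT (L j).
Proof.
apply: (@ae_le_integrable _ _ _ P setT measurableT (L j) (E j M)).
- by apply: Gmeasurable_measurable => //; exact: lookahead_Gmeasurable.
- apply: filterS2 (lookahead_ge0 j) (lookahead_le_sup j) => w h0 h _.
  by rewrite gee0_abs//; apply: (le_trans h); exact: lee_abs.
- exact: condexp_integrable.
Qed.

Lemma stopped_consistent_K j k : (j <= k)%N ->
  {ae P, forall w, K j w -> stopped U (sigma k) w = 0}.
Proof.
move=> jk.
have h : {ae P, forall w, forall n, (k <= n)%N -> K j w -> U n w = 0}.
  apply: ae_foralln => n; have [kn|kn] := boolP (k <= n)%N; last exact: aeW.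
  by apply: filterS (UK (leq_trans jk kn)) => w h _.
apply: filterS2 h (consistent_ge k) => w h kt Kw.
case: (stopping_value (consistent_stopping k) w) => [e|[n e]].
  by rewrite /stopped e.
by rewrite (stoppedE e) h//; move: kt; rewrite e lee_nat.
Qed.

(** On [K j] every policy started at j or later earns nothing. Hence L_j <= 0 <= U_j there, and the
    updated policy stops. *)
Lemma lookahead_K j : {ae P, forall w, K j w -> L j w <= 0}.
Proof.
have int0 : P.-integrable setT (cst 0 : Omega -> \bar R) by exact: integrable0.
have E0 : {ae P, forall w, E j (cst 0) w = 0 :> \bar R}.
  by apply: condexp_id => //; apply/(GmeasurableP (sG j)); exact: measurable_cst.
have h k : {ae P, forall w, (j <= k)%N -> K j w -> E j (stopped U (sigma k)) w <= 0}.
  have [jk|jk] := boolP (j <= k)%N; last exact: aeW.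
  have := condexp_le_on (sG j) (@Gm j) (GK j) (stX k) int0.
  have h : {ae P, forall w, K j w -> stopped U (sigma k) w <= cst 0 w}.
    by apply: filterS (stopped_consistent_K jk) => w h Kw; rewrite h.
  by move=> /(_ h){}h; apply: filterS2 h E0 => w h <- _.
apply: filterS (ae_foralln h) => w {}h Kw.
by apply: lookahead_lub => k [jk _]; exact: h.
Qed.

(* A term of the window that continues past j is also a term of the window of
   j + 1: k > j by inclusion of the windows, k = j by consistency. *)
Lemma lookahead_step j :
  {ae P, forall w, L j w <= Order.max (U j w) (E j (L j.+1) w)}.
Proof.
have hnext k : {ae P, forall w, window kappa j k -> (j < k)%N ->
    E j (stopped U (sigma k)) w <= E j (L j.+1) w}.
  have [jk|jk] := boolP (j < k)%N; last by apply: aeW => w _.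
  have [wk|wk] := pselect (window kappa j k); last exact: aeW.
  have h : {ae P, forall w, E j (E j.+1 (stopped U (sigma k))) w <= E j (L j.+1) w}.
    apply: condexp_le => //; [exact: condexp_integrable|exact: lookahead_integrable|].
    by apply: aeW => w; apply: lookahead_ub; exact: window_succ.
  have h' := condexp_tower (sG j) (@Gm j) (sG j.+1) (@Gm j.+1) (Gmono (leqnSn j)) (stX k).
  by apply: filterS2 h h' => w + <- _.
have hhere : {ae P, forall w, sigma j w = j%:R%:E -> E j (stopped U (sigma j)) w = U j w}.
  have h : {ae P, forall w, sigma j w = j%:R%:E -> E j (stopped U (sigma j)) w = E j (U j) w}.
    apply: (condexp_eq_on (sG j) (@Gm j)) => //; last by apply: aeW => w e; rewrite (stoppedE e).
      by apply: stopping_eq => //; exact: consistent_stopping.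
    exact: U_integrable.
  by apply: filterS2 h (E_U (leqnn j)) => w h <-.
have hcont : {ae P, forall w, j%:R%:E < sigma j w ->
    E j (stopped U (sigma j)) w = E j (stopped U (sigma j.+1)) w}.
  apply: (condexp_eq_on (sG j) (@Gm j)) => //.
    by apply: stopping_gt; exact: consistent_stopping.
  by apply: filterS (consistent_eq j) => w h /h e; rewrite /stopped e.
have hj := hnext j.+1.
near=> w.
apply: lookahead_lub => k wk; rewrite le_max; apply/orP.
have [e|ne] := eqVneq k j; last first.
  right; have := wk; case=> jk _; have : (j < k)%N by rewrite ltn_neqAle eq_sym ne.
  move: wk; move: k {ne jk}.
  by near: w; apply: ae_foralln => k; exact: hnext.
rewrite {}e in wk *.
have : j%:R%:E <= sigma j w by near: w; exact: consistent_ge.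
rewrite le_eqVlt => /orP[/eqP e|jlt].
  by left; rewrite (near hhere).
right; rewrite (near hcont)//.
apply: (near hj) => //; exact: window_next.
Unshelve. all: by end_near. Qed.

Let rho i w : \bar R := first_from i (fun j => L j w <= U j w).

Lemma improved_stopping i : stopping (rho i).
Proof.
apply: (@stopping_first_from i (fun j => [set w | L j w <= U j w])) => j.
by apply: Gmeasurable_le => //; exact: lookahead_Gmeasurable.
Qed.

Lemma improved_lty : {ae P, forall w, forall i, rho i w < +oo}.
Proof.
apply: (@ae_first_from_lty (fun j w => L j w <= U j w)) => j.
by apply: filterS (lookahead_K j) => w h /h Lj; exact: le_trans (U0 j w).
Qed.

(** The stopping rule [L j <= U j] does not involve i: the first entries, from the various i, into
    one common set of indices always form a consistent family. *)
Lemma improved_consistent : consistent_family P G rho.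
Proof.
split=> [i|i|i]; first exact: improved_stopping.
  by apply: filterS improved_lty => w h; split; first exact: first_from_ge.
apply: aeW => w h; apply: first_from_succ; apply: first_from_neq h; exact: leqnn.
Qed.

Lemma lookahead_le_improved i : {ae P, forall w, L i w <= E i (stopped U (rho i)) w}.
Proof.
have st := improved_stopping i.
have intL := lookahead_integrable.
(* Before rho_i the rule fails, so U_n < L_n and [lookahead_step] leaves L_n <= E_n[L_(n+1)]; at
   rho_i = n the rule itself gives L_n <= U_n. Hence the one-step inequality in each case. *)
pose g n := stopped_or (rho i) n (L n).
have intg n : P.-integrable setT (g n) by exact: stopped_or_integrable.
have stepg n : (i <= n)%N -> {ae P, forall w, g n w <= E n (g n.+1) w}.
  move=> le_in.
  have h := @condexp_stopped_or _ st n.+1 n (L n.+1) (leqnn _) (intL _).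
  apply: filterS2 h (lookahead_step n) => w -> {}h.
  rewrite /g; have [e|[k e]] := stopping_value st w.
    rewrite !stopped_or_ge ?e ?leey//.
    have : ~ L n w <= U n w.
      by apply: (@first_from_neq R i (fun j => L j w <= U j w)) => //; rewrite -/(rho i w) e ltry.
    move=> /negP; rewrite -ltNge => UL.
    by move: h; rewrite le_max [L n w <= U n w]leNgt UL.
  have [kn|nk|nk] := ltngtP k n.
  - by rewrite (stopped_orE _ kn e) (stopped_orE _ (leqW kn : (k < n.+1)%N) e).
  - rewrite !stopped_or_ge ?e ?lee_nat//; last exact: ltnW.
    have : ~ L n w <= U n w.
      apply: (@first_from_neq R i (fun j => L j w <= U j w)) => //.
      by rewrite -/(rho i w) e lte_nat.
    move=> /negP; rewrite -ltNge => UL.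
    by move: h; rewrite le_max [L n w <= U n w]leNgt UL.
  - rewrite nk in e *; rewrite stopped_or_ge ?e// (stopped_orE _ (leqnn _) e).
    case: (@first_fromP R i (fun j => L j w <= U j w)); rewrite -/(rho i w) e; first by case.
    by move=> [k' [/nat_EFin_inj <-]].
(* The g n are not dominated by M, since only L_n <= E_n[M] is known. With continuation payoff M in
   place of L_n the sequence is dominated by M, its conditional expectation given G_i is no smaller,
   and its limit is still the stopped reward because rho_i is finite. *)
have intf n : P.-integrable setT (stopped_or (rho i) n M) by exact: stopped_or_integrable.
have LM n : (i <= n)%N -> {ae P, forall w, L i w <= E i (stopped_or (rho i) n M) w}.
  move=> le_in.
  have h0 : {ae P, forall w, L i w = E i (g i) w}.
    have := condexp_id (sG i) (@Gm i) (@lookahead_Gmeasurable i) (intL i).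
    have gi : g i = L i by apply/funext => w; rewrite /g stopped_or_ge//; exact: first_from_ge.
    by rewrite gi; apply: filterS => w ->.
  have h1 := condexp_chain_le intg stepg le_in.
  have h2 : {ae P, forall w, g n w <= E n (stopped_or (rho i) n M) w}.
    have h := @condexp_stopped_or _ st n n M (leqnSn _) intM.
    apply: filterS2 h (lookahead_le_sup n) => w -> {}h.
    by rewrite /g /stopped_or; case: ifP.
  have h3 : {ae P, forall w, E i (g n) w <= E i (E n (stopped_or (rho i) n M)) w}.
    by apply: condexp_le => //; exact: condexp_integrable.
  have h4 := condexp_tower (sG i) (@Gm i) (sG n) (@Gm n) (Gmono le_in) (intf n).
  near=> w.
  rewrite (near h0)//; apply: (@le_trans _ _ (E i (g n) w)); first exact: (near h1).
  rewrite -(near h4)//; exact: (near h3).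
apply: (@condexp_lim_ge _ _ _ P (G i) (sG i) (@Gm i) (fun n => stopped_or (rho i) n M) _ M) => //.
- by move=> n; exact: measurable_int (intf n).
- exact: stopped_measurable.
- by apply: filterS improved_lty => w h; exact: stopped_or_cvg.
- apply: aeW => w n; rewrite gee0_abs /stopped_or; case: ifP => _.
  + exact: stopped_le_sup.
  + by [].
  + exact: stopped_ge0.
  + exact: sup_ge0.
- exact: lookahead_Gmeasurable.
- by exists i.
Unshelve. all: by end_near. Qed.

(** Either U_i <= L_i, and L_i is below the new value, or L_i < U_i, and the update stops at i and
    earns U_i. *)
Lemma U_le_improved i : {ae P, forall w, U i w <= E i (stopped U (rho i)) w}.
Proof.
have st := improved_stopping i.
have h : {ae P, forall w, rho i w = i%:R%:E -> E i (stopped U (rho i)) w = E i (U i) w}.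
  apply: (condexp_eq_on (sG i) (@Gm i)) => //.
  - exact: stopping_eq.
  - exact: stopped_integrable.
  - exact: U_integrable.
  - by apply: aeW => w e; rewrite (stoppedE e).
apply: filterS3 h (E_U (leqnn i)) (lookahead_le_improved i) => w h e LE.
have [UL|LU] := leP (U i w) (L i w); first exact: le_trans LE.
by rewrite h ?e//; apply: first_from_here; exact: ltW.
Qed.

End one_policy.

(** * Monotonicity and convergence of the iterated policies *)

Section iteration.
Variables (kappa : option nat) (hkappa : kappa <> Some 0%N).
Variables (sigma0 : nat -> Omega -> \bar R).
Hypothesis csigma0 : consistent_family P G sigma0.

Let pol := policy P G U kappa sigma0.
Let Lk m := lookahead P G U kappa (pol m).

Lemma policy_consistent m : consistent_family P G (pol m).
Proof. by elim: m => [//|m IH]; exact: improved_consistent. Qed.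

Let stpol m k : stopping (pol m k).
Proof. by case: (policy_consistent m). Qed.

Let intpol m k : P.-integrable setT (stopped U (pol m k)).
Proof. exact: stopped_integrable. Qed.

Lemma lookahead_le_value m i : {ae P, forall w, Lk m i w <= E i (stopped U (pol m.+1 i)) w}.
Proof. exact: (lookahead_le_improved hkappa (policy_consistent m)). Qed.

Lemma U_le_value m i : {ae P, forall w, U i w <= E i (stopped U (pol m.+1 i)) w}.
Proof. exact: (U_le_improved hkappa (policy_consistent m)). Qed.

(** The index i lies in its own window, so the current value is a term of L_i. This covers m = 0 as
    well, even where the first update moves a time backwards. *)
Lemma value_nd m i : {ae P, forall w,
  E i (stopped U (pol m i)) w <= E i (stopped U (pol m.+1 i)) w}.
Proof.
apply: filterS (lookahead_le_value m i) => w; apply: le_trans.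
by apply: lookahead_ub; exact: window_self.
Qed.

Lemma condexp_policy_nd m i k : (i <= k)%N -> {ae P, forall w,
  E i (stopped U (pol m k)) w <= E i (stopped U (pol m.+1 k)) w}.
Proof.
move=> ik.
have h : {ae P, forall w, E i (E k (stopped U (pol m k))) w <=
    E i (E k (stopped U (pol m.+1 k))) w}.
  by apply: condexp_le => //; [exact: condexp_integrable..|exact: value_nd].
have t n := condexp_tower (sG i) (@Gm i) (sG k) (@Gm k) (Gmono ik) (intpol n k).
by apply: filterS3 h (t m) (t m.+1) => w + <- <-.
Qed.

Lemma lookahead_nd m j : {ae P, forall w, Lk m j w <= Lk m.+1 j w}.
Proof.
have h k : {ae P, forall w, (j <= k)%N ->
    E j (stopped U (pol m k)) w <= E j (stopped U (pol m.+1 k)) w}.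
  have [jk|jk] := boolP (j <= k)%N; last exact: aeW.
  by apply: filterS (condexp_policy_nd m jk) => w h _.
apply: filterS (ae_foralln h) => w {}h; apply: lookahead_lub => k wk.
by apply: (le_trans (h k _)); [case: wk|exact: lookahead_ub].
Qed.

(** Continuing at j under the updated policy means U_j < L_j^(m), and L_j^(m) <= L_j^(m+1). Only the
    initial family can overshoot. *)
Lemma policy_no_overshoot m : no_overshoot P G U kappa (pol m.+1).
Proof.
move=> j; apply: filterS (lookahead_nd m j) => w LL h.
apply: lt_le_trans LL; rewrite ltNge; apply/negP.
by apply: (@first_from_neq R j (fun j => Lk m j w <= U j w)) h.
Qed.

(** Let k be the new time of i. The update stops at k, so the old policy, which does not overshoot,
    satisfies sigma_k = k. Consistency carries the bound sigma <= k backwards from k to i. *)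
Lemma policy_nd m i : no_overshoot P G U kappa (pol m) ->
  {ae P, forall w, pol m i w <= pol m.+1 i w}.
Proof.
move=> no; have cs := policy_consistent m.
have hge := ae_foralln (consistent_ge cs).
have heq := ae_foralln (consistent_eq cs).
apply: filterS3 (ae_foralln no) hge heq => w {}no {}hge {}heq.
rewrite /pol /= -/(pol m) -/(Lk m).
case: (@first_fromP R i (fun j => Lk m j w <= U j w)) => [[-> _]|[k [-> ik LU _]]].
  exact: leey.
have kk : pol m k w = k%:R%:E.
  apply/eqP; rewrite eq_le hge andbT leNgt; apply/negP => /no.
  by rewrite ltNge LU.
(* Backward induction: the time of k - n - 1 is either k - n - 1 itself or the time of k - n. *)
have le_k n : (n <= k - i)%N -> pol m (k - n)%N w <= k%:R%:E.
  elim: n => [|n IH] nk; first by rewrite subn0 kk.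
  have := hge (k - n.+1)%N; rewrite le_eqVlt => /orP[/eqP <-|/heq ->].
    by rewrite lee_nat leq_subr.
  by rewrite -subSn ?subSS; [apply: IH; exact: ltnW|apply: (leq_trans nk); exact: leq_subr].
by have := le_k _ (leqnn _); rewrite subKn.
Qed.

(** The time sigma^oo_i of the overview. Being given by a stopping rule and not as a limit of times,
    it is a stopping time without any exceptional event. *)
Definition limit_time i w : \bar R := first_from i (fun j => forall m, Lk m j w <= U j w).

Lemma limit_time_stopping i : stopping (limit_time i).
Proof.
apply: (@stopping_first_from i (fun j => [set w | forall m, Lk m j w <= U j w])) => j.
have -> : [set w | forall m, Lk m j w <= U j w] = \bigcap_m [set w | Lk m j w <= U j w].
  by apply/seteqP; split => w /= h m => [_|]; exact: h.
apply: sub_sigma_bigcap => // m; apply: Gmeasurable_le => //.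
exact: lookahead_Gmeasurable.
Qed.

Let intlim i : P.-integrable setT (stopped U (limit_time i)).
Proof. by apply: stopped_integrable; exact: limit_time_stopping. Qed.

Lemma limit_time_lty : {ae P, forall w, forall i, limit_time i w < +oo}.
Proof.
apply: (@ae_first_from_lty (fun j w => forall m, Lk m j w <= U j w)) => j.
have h m := lookahead_K kappa (policy_consistent m) j.
by apply: filterS (ae_foralln h) => w {}h Kw m; exact: le_trans (h m Kw) (U0 j w).
Qed.

Lemma policy_le_limit_time m i w : pol m.+1 i w <= limit_time i w.
Proof. by apply: first_from_sub => j; exact. Qed.

(** If the limit time is k, each of the finitely many j with i <= j < k violates the rule for some
    m, and then for all larger m because L^(m) is monotone. The rule holds at k for every m, so from
    some m on the times coincide. *)
Lemma policy_near_limit_time :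
  {ae P, forall w, forall i, \forall m \near \oo, pol m i w = limit_time i w}.
Proof.
have hnd : {ae P, forall w, forall j, nondecreasing_seq (fun m => Lk m j w)}.
  apply: ae_foralln => j.
  by apply: filterS (ae_foralln (lookahead_nd^~ j)) => w /nondecreasing_seqP.
apply: filterS2 hnd limit_time_lty => w nd fin i.
have := fin i; rewrite /limit_time.
case: (@first_fromP R i (fun j => forall m, Lk m j w <= U j w)) => [[-> _]//|].
move=> [k [e ik Sk nS _]].
have [N _ hN] : \forall m \near \oo, forall j, (j < k)%N -> (i <= j)%N -> ~ (Lk m j w <= U j w).
  apply: near_ltn => j jk; have [ij|ij] := boolP (i <= j)%N; last exact: nearW.
  have /existsNP[m Lm] := nS j ij jk.
  exists m => // m' /= mm' _ LU; apply: Lm; apply: le_trans LU; exact: nd.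
(* Shift by one: [pol m.+1] is built from [Lk m]. *)
exists N.+1 => // -[//|m] /= Nm; apply/eqP; rewrite eq_le policy_le_limit_time /=.
rewrite /limit_time e /pol /= -/(pol m) -/(Lk m).
case: (@first_fromP R i (fun j => Lk m j w <= U j w)) => [[-> _]|[k' [-> ik' Sk' _]]].
  exact: leey.
rewrite lee_nat leqNgt; apply/negP => k'k.
exact: (hN m Nm k').
Qed.

Let stopped_policy_cvg k :
  {ae P, forall w, stopped U (pol m k) w @[m --> \oo] --> stopped U (limit_time k) w}.
Proof.
apply: filterS policy_near_limit_time => w /(_ k) h.
by apply: cvg_near_cst; apply: filterS h => m; rewrite /stopped => ->.
Qed.

Let stopped_policy_dom k : {ae P, forall w m, `|stopped U (pol m k) w| <= M w}.
Proof. by apply: aeW => w m; rewrite gee0_abs ?stopped_ge0// stopped_le_sup. Qed.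

(** Reward convergence comes from the eventual equality of the times, domination from M, and
    monotonicity from [condexp_policy_nd]. Indices k > i are included because windows look ahead. *)
Lemma condexp_policy_cvg i k : (i <= k)%N -> {ae P, forall w,
  E i (stopped U (pol m k)) w @[m --> \oo] --> E i (stopped U (limit_time k)) w}.
Proof.
move=> ik; apply: (condexp_monotone_cvg (sG i) (@Gm i) (M := M)) => //.
- by move=> m; exact: stopped_measurable.
- by apply: stopped_measurable; exact: limit_time_stopping.
- by move=> m; exact: condexp_policy_nd.
Qed.

Lemma condexp_policy_le m i k : (i <= k)%N -> {ae P, forall w,
  E i (stopped U (pol m k)) w <= E i (stopped U (limit_time k)) w}.
Proof.
move=> ik; apply: (condexp_monotone_le (sG i) (@Gm i)
  (f_ := fun n => stopped U (pol n k)) (M := M)) => //.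
- by move=> n; exact: stopped_measurable.
- by apply: stopped_measurable; exact: limit_time_stopping.
- by move=> n; exact: condexp_policy_nd.
Qed.

Let V i := E i (stopped U (limit_time i)).

Lemma limit_value_integrable i : P.-integrable setT (V i).
Proof. exact: condexp_integrable. Qed.

Lemma lookahead_le_limit_value m i : {ae P, forall w, Lk m i w <= V i w}.
Proof.
apply: filterS2 (lookahead_le_value m i) (condexp_policy_le m.+1 (leqnn i)) => w.
exact: le_trans.
Qed.

Lemma U_le_limit_value i : {ae P, forall w, U i w <= V i w}.
Proof.
apply: filterS2 (U_le_value 0 i) (condexp_policy_le 1 (leqnn i)) => w.
exact: le_trans.
Qed.

(** By the tower property, E_i[V_(i+1)] is the limit of E_i[U_(sigma^(m)_(i+1))]. Since i + 1 is in
    the window of i, each of these is at most L_i^(m), hence at most V_i. *)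
Lemma limit_value_supermartingale i : {ae P, forall w, E i (V i.+1) w <= V i w}.
Proof.
have tw := condexp_tower (sG i) (@Gm i) (sG i.+1) (@Gm i.+1) (Gmono (leqnSn i)) (intlim i.+1).
apply: filterS3 tw (condexp_policy_cvg (leqnSn i)) (ae_foralln (lookahead_le_limit_value^~ i)).
move=> w -> cv LV; rewrite -(cvg_lim _ cv)//.
apply: lime_le; first by apply/cvg_ex; eexists; exact: cv.
apply: nearW => m; apply: le_trans (LV m).
by apply: lookahead_ub; exact: window_next.
Qed.

Lemma limit_value_ge0 i : {ae P, forall w, 0 <= V i w}.
Proof. by apply: condexp_ge0 => //; apply: aeW => w; exact: stopped_ge0. Qed.

Lemma stopped_le_limit_value i t : stopping t ->
  {ae P, forall w, i%:R%:E <= t w} -> {ae P, forall w, t w < +oo} ->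
  {ae P, forall w, E i (stopped U t) w <= V i w}.
Proof.
move=> st ge_i lty.
pose g n := stopped_or t n (V n).
have intV := limit_value_integrable.
have intg n : P.-integrable setT (g n) by exact: stopped_or_integrable.
have stepg n : (i <= n)%N -> {ae P, forall w, E n (g n.+1) w <= g n w}.
  move=> le_in.
  have h := @condexp_stopped_or _ st n.+1 n (V n.+1) (leqnn _) (intV _).
  apply: filterS3 h (limit_value_supermartingale n) (U_le_limit_value n) => w -> EV UV.
  rewrite /g; have [e|[k e]] := stopping_value st w.
    by rewrite !stopped_or_ge ?e ?leey.
  have [kn|nk|nk] := ltngtP k n.
  - by rewrite (stopped_orE _ kn e) (stopped_orE _ (leqW kn : (k < n.+1)%N) e).
  - by rewrite !stopped_or_ge ?e ?lee_nat//; exact: ltnW.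
  - by rewrite nk in e; rewrite [leRHS]stopped_or_ge ?e// (stopped_orE _ (leqnn _) e).
have int0 : P.-integrable setT (cst 0 : Omega -> \bar R) by exact: integrable0.
(* Since V_n >= 0, continuation payoff 0 lowers the value and makes the sequence dominated by M; the
   limit is unchanged because t is finite almost surely. *)
pose f n := stopped_or t n (cst 0).
have intf n : P.-integrable setT (f n) by exact: stopped_or_integrable.
have fV n : (i <= n)%N -> {ae P, forall w, E i (f n) w <= V i w}.
  move=> le_in.
  have h1 : {ae P, forall w, E i (f n) w <= E i (g n) w}.
    apply: condexp_le => //; apply: filterS (limit_value_ge0 n) => w V0.
    by rewrite /f /g /stopped_or; case: ifP.
  have h2 := condexp_chain_ge intg stepg le_in.
  have h3 : {ae P, forall w, E i (g i) w = E i (V i) w}.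
    by apply: condexp_eq => //; apply: filterS ge_i => w h; exact: stopped_or_ge.
  have h4 : {ae P, forall w, E i (V i) w = V i w}.
    by apply: condexp_id => //; exact: condexp_Gmeasurable.
  near=> w; rewrite -(near h4)// -(near h3)//.
  by apply: (@le_trans _ _ (E i (g n) w)); [exact: (near h1)|exact: (near h2)].
apply: (condexp_lim_le (sG i) (@Gm i) (f_ := f) (M := M)) => //.
- by move=> n; exact: measurable_int (intf n).
- exact: stopped_measurable.
- by apply: filterS lty => w; exact: stopped_or_cvg.
- apply: aeW => w n; rewrite gee0_abs /f /stopped_or; case: ifP => _ //.
  + exact: stopped_le_sup.
  + exact: sup_ge0.
  + exact: stopped_ge0.
- exact: condexp_Gmeasurable.
- by exists i.
Unshelve. all: by end_near. Qed.

Let family i := [set E i (stopped U n) | n in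
  [set n | [/\ stopping n, (forall w, n w < +oo) & {ae P, forall w, i%:R%:E <= n w}]]].

(* The limit time may be infinite on a null event, where it is replaced by i to
   obtain a member of the family defining the Snell envelope. *)
Lemma limit_value_attained i : exists2 X, family i X & {ae P, forall w, X w = V i w}.
Proof.
pose n w : \bar R := if limit_time i w < +oo then limit_time i w else i%:R%:E.
have lim_st := limit_time_stopping i.
have neq : {ae P, forall w, n w = limit_time i w}.
  by apply: filterS limit_time_lty => w /(_ i); rewrite /n => ->.
have nst : stopping n.
  split=> [w|k].
    rewrite /n; case: ifP => _; last by right; exists i.
    exact: (stopping_value lim_st).
  (* The change from the limit time to n takes place on a null event, and null events lie in G_k. *)
  apply: (sub_sigma_ae (sG k) (@Gnull k) (stopping_le k lim_st)).
  by apply: filterS neq => w /= ->.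
exists (E i (stopped U n)).
  exists n => //; split => //.
    by move=> w; rewrite /n; case: ifP => // _; exact: ltry.
  by apply: aeW => w; rewrite /n; case: ifP => // _; exact: first_from_ge.
apply: condexp_eq => //; first exact: stopped_integrable.
by apply: filterS neq => w; rewrite /stopped => ->.
Qed.

Lemma limit_value_esssup i : is_esssup P (family i) (V i).
Proof.
split.
- by apply: Gmeasurable_measurable => //; exact: condexp_Gmeasurable.
- move=> _ [n [st lty ge_i] <-]; apply: stopped_le_limit_value => //; exact: aeW.
- move=> Y' _ ub; have [X FX XV] := limit_value_attained i.
  by apply: filterS2 XV (ub X FX) => w ->.
Qed.

(** V_i witnesses that an essential supremum exists, so the choice behind [snell] is not its dummy
    value. *)
Lemma snell_esssup i : is_esssup P (family i) (snell P G U i).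
Proof. by apply: xgetPex; exists (V i); exact: limit_value_esssup. Qed.

Lemma snellE i : {ae P, forall w, snell P G U i w = V i w}.
Proof.
have [mS ubS leastS] := snell_esssup i; have [mV ubV leastV] := limit_value_esssup i.
apply: filterS2 (leastS _ mV ubV) (leastV _ mS ubS) => w h1 h2.
by apply/eqP; rewrite eq_le h1 h2.
Qed.

Lemma snell_integrable i : P.-integrable setT (snell P G U i).
Proof.
have [mS _ _] := snell_esssup i.
apply: (ae_le_integrable measurableT mS _ (limit_value_integrable i)).
by apply: filterS (snellE i) => w ->.
Qed.

Lemma condexp_snell j : {ae P, forall w,
  E j (snell P G U j.+1) w = E j (stopped U (limit_time j.+1)) w}.
Proof.
have h : {ae P, forall w, E j (snell P G U j.+1) w = E j (V j.+1) w}.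
  apply: condexp_eq => //; [exact: snell_integrable|exact: limit_value_integrable|exact: snellE].
have tw := condexp_tower (sG j) (@Gm j) (sG j.+1) (@Gm j.+1) (Gmono (leqnSn j)) (intlim j.+1).
by apply: filterS2 h tw => w -> <-.
Qed.

(** Both stopping rules agree at each j. If L_j^(m) <= U_j for all m, the window term k = j + 1
    gives E_j[U_(sigma^(m)_(j+1))] <= U_j, and m tends to infinity. Conversely, [lookahead_step]
    bounds L_j^(m) by the maximum of U_j and E_j[V_(j+1)], which is U_j under the optimal rule. *)
Lemma optimal_timeE : {ae P, forall w, forall i, optimal_time P G U i w = limit_time i w}.
Proof.
have h : {ae P, forall w, forall j,
    (forall m, Lk m j w <= U j w) <-> (E j (snell P G U j.+1) w <= U j w)}.
  apply: ae_foralln => j.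
  have stepL : {ae P, forall w, forall m, Lk m j w <= Order.max (U j w) (E j (Lk m j.+1) w)}.
    by apply: ae_foralln => m; exact: (lookahead_step hkappa (policy_consistent m)).
  have LV : {ae P, forall w, forall m, E j (Lk m j.+1) w <= E j (V j.+1) w}.
    apply: ae_foralln => m; apply: condexp_le => //.
    - exact: (lookahead_integrable kappa (policy_consistent m)).
    - exact: limit_value_integrable.
    - exact: lookahead_le_limit_value.
  have tw := condexp_tower (sG j) (@Gm j) (sG j.+1) (@Gm j.+1) (Gmono (leqnSn j)) (intlim j.+1).
  near=> w.
  rewrite (near (condexp_snell j))//; split => [LU|CU m].
    have cv : E j (stopped U (pol m j.+1)) w @[m --> \oo] --> E j (stopped U (limit_time j.+1)) w.
      by near: w; exact: condexp_policy_cvg.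
    rewrite -(cvg_lim _ cv)//; apply: lime_le; first by apply/cvg_ex; eexists; exact: cv.
    apply: nearW => m; apply: le_trans (LU m).
    by apply: lookahead_ub; exact: window_next.
  have h1 : Lk m j w <= Order.max (U j w) (E j (Lk m j.+1) w) by move: m; near: w.
  have h2 : E j (Lk m j.+1) w <= E j (V j.+1) w by move: m {h1}; near: w.
  apply: (le_trans h1); rewrite ge_max lexx /=; apply: (le_trans h2).
  by rewrite (near tw).
apply: filterS h => w h i; rewrite /optimal_time /limit_time.
by apply: eq_first_from => j _; split => /h.
Unshelve. all: by end_near. Qed.

Theorem discrete_policy_iteration :
  [/\ forall m i, (0 < m)%N \/ no_overshoot P G U kappa sigma0 ->
        {ae P, forall w, pol m i w <= pol m.+1 i w},
      forall m i, {ae P, forall w, pol m.+1 i w <= optimal_time P G U i w},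
      forall i, {ae P, forall w, optimal_time P G U i w < +oo},
      forall i, {ae P, forall w, pol m i w @[m --> \oo] --> optimal_time P G U i w} &
      (forall m i, {ae P, forall w, policy_value P G U kappa sigma0 m i w <=
                                    policy_value P G U kappa sigma0 m.+1 i w}) /\
      (forall i, {ae P, forall w, policy_value P G U kappa sigma0 m i w @[m --> \oo] -->
                                  snell P G U i w})].
Proof.
split=> [m i no|m i|i|i|]; last split=> [m i|i].
- by apply: policy_nd; case: m no => [[//|//]|m _]; exact: policy_no_overshoot.
- by apply: filterS optimal_timeE => w ->; exact: policy_le_limit_time.
- by apply: filterS2 optimal_timeE limit_time_lty => w ->.
- apply: filterS2 optimal_timeE policy_near_limit_time => w -> h.
  by apply: cvg_near_cst; exact: h.
- exact: value_nd.
- by apply: filterS2 (snellE i) (condexp_policy_cvg (leqnn i)) => w ->.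
Qed.

End iteration.

End discrete.

(** * Sampling the reward at stopping times *)

Section stopping_sigma.
Context {d : measure_display} {Omega : measurableType d} {R : realType}.
Variables (P : probability Omega R) (F : \bar R -> set (set Omega)).
Hypotheses (hF : filtration F) (hFusual : usual_conditions P F).
Implicit Types (tau : Omega -> \bar R) (t : \bar R).

Lemma filtration_sigma t : 0 <= t -> sigma_algebra setT (F t).
Proof. by case: hF => + _ _; exact. Qed.

Lemma filtration_mono s t : 0 <= s -> s <= t -> F s `<=` F t.
Proof. by case: hF => _ _; exact. Qed.

Lemma filtration_null t A : 0 <= t -> P.-negligible A -> F t A.
Proof. by move=> t0 NA; apply: (filtration_mono (lexx 0) t0); case: hFusual => _; exact. Qed.

Lemma stopping_time_le tau s t : stopping_time F tau -> 0 <= s -> s <= t ->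
  F t [set w | tau w <= s].
Proof. by move=> [_ h] s0 st; apply: (filtration_mono s0 st); exact: h. Qed.

Lemma stopping_sigma_algebra tau : stopping_time F tau ->
  sigma_algebra setT (stopping_sigma F tau).
Proof.
move=> st; split=> [t t0|A GA t t0|A GA t t0].
- by rewrite set0I; case: (filtration_sigma t0).
- rewrite setTD setIC -setDE.
  have -> : [set w | tau w <= t] `\` A = [set w | tau w <= t] `\` (A `&` [set w | tau w <= t]).
    by rewrite setDIr setDv setU0.
  apply: (sub_sigmaD (filtration_sigma t0)); last exact: GA.
  exact: stopping_time_le.
- rewrite setI_bigcupl; apply: (sub_sigma_bigcup (filtration_sigma t0)) => i.
  exact: GA.
Qed.

Lemma stopping_sigma_measurable tau : stopping_sigma F tau `<=` measurable.
Proof.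
move=> A /(_ +oo); rewrite leey => /(_ erefl); case: hF => _ Fm _.
rewrite (_ : [set w | tau w <= +oo] = setT) ?setIT.
  by apply: Fm; rewrite leey.
by rewrite -subTset => w _ /=; rewrite leey.
Qed.

Lemma stopping_sigma_null tau A : P.-negligible A -> stopping_sigma F tau A.
Proof. by move=> NA t t0; apply: filtration_null => //; apply: negligibleS NA => w []. Qed.

(** The order of the two times is only almost sure: A intersected with {tau' <= t} lies in F_t up to
    a null event, which F_t absorbs. *)
Lemma stopping_sigma_mono tau tau' : stopping_time F tau' ->
  {ae P, forall w, tau w <= tau' w} -> stopping_sigma F tau `<=` stopping_sigma F tau'.
Proof.
move=> st' le_tau A GA t t0.
apply: (@sub_sigma_ae _ _ _ P (F t) (filtration_sigma t0) _
  (A `&` [set w | tau w <= t] `&` [set w | tau' w <= t])).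
- by move=> N; exact: filtration_null.
- apply: (sub_sigmaI (filtration_sigma t0)); first exact: GA.
  exact: stopping_time_le.
- apply: filterS le_tau => w h /=; split=> [[[]]//|[Aw w't]].
  by split => //; split => //; exact: le_trans w't.
Qed.

Lemma stopping_time_lt tau (s : R) t : stopping_time F tau -> s%:E <= t -> 0 <= t ->
  F t [set w | tau w < s%:E].
Proof.
move=> st le_st t0; have sFt := filtration_sigma t0.
have [s0|s0] := leP s 0%R.
  rewrite (_ : [set _ | _] = set0); first by case: sFt.
  rewrite -subset0 => w /= ws; case: st => /(_ w) w0 _.
  by have := le_lt_trans w0 ws; rewrite lte_fin ltNge s0.
(* Approximation of s from below; the cut at 0 keeps the times r n in the range where F is a
   filtration. *)
pose r n : R := (Num.max 0 (s - n.+1%:R^-1))%R.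
have rs n : (r n < s)%R by rewrite gt_max s0/= ltrBlDr ltrDl invr_gt0.
have -> : [set w | tau w < s%:E] = \bigcup_n [set w | tau w <= (r n)%:E].
  apply/seteqP; split => w /=; last first.
    by move=> [n _ /= h]; apply: (le_lt_trans h); rewrite lte_fin.
  case: st => /(_ w); case e : (tau w) => [x||]// _ _; rewrite lte_fin => xs.
  have [n xn] := ltr_add_invr xs.
  by exists n => //=; rewrite e lee_fin /r le_max lerBrDr (ltW xn) orbT.
apply: sub_sigma_bigcup => // n; apply: stopping_time_le => //.
  by rewrite lee_fin /r le_max lexx.
by apply: le_trans le_st; rewrite lee_fin ltW.
Qed.

Variables (T : R) (Z : R -> Omega -> R).
Hypotheses (hT : (0 < T)%R) (hZ : reward_process P F T Z).

Lemma adapted_Gmeasurable (s : R) t : (0 <= s)%R -> s%:E <= t ->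
  Gmeasurable (F t) (fun w => (Z s w)%:E).
Proof.
move=> s0 st B mB; case: hZ => _ aZ _ _.
have s0' : 0 <= s%:E by rewrite lee_fin.
apply: (filtration_mono s0' st).
have mB' : measurable ((@EFin R) @^-1` B).
  by rewrite -[X in measurable X]setTI; exact: EFin_measurable.
exact: (aZ s s0 _ mB').
Qed.

Section sampling.
Variables (tau : Omega -> \bar R) (st : stopping_time F tau).
Hypothesis tau_lty : {ae P, forall w, tau w < +oo}.

Let u (w : Omega) : \bar R := (Z (fine (tau w)) w)%:E.

(* Before t <= T the process is right-continuous, so that u is there the limit of
   the values of Z at the points of a grid of mesh 1/(n+1) following tau. *)
Let sampled_lt (t : R) : (0 <= t)%R -> (t <= T)%R ->
  Gmeasurable (F t%:E) (fun w => if tau w < t%:E then u w else 0).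
Proof.
move=> t0 tT; have t0' : 0 <= t%:E by rewrite lee_fin.
have sFt := filtration_sigma t0'.
(* The cut at t makes every grid value of Z measurable for F_t. As tau < t, the grid point following
   tau is still strictly to its right, as a right limit requires. *)
pose grid n (k : nat) : R := (Num.min t (k%:R / n.+1%:R))%R.
pose step n w := Num.truncn (fine (tau w) * n.+1%:R)%R.
pose v n w : \bar R := if tau w < t%:E then (Z (grid n (step n w).+1) w)%:E else 0.
have grid0 n k : (0 <= grid n k)%R by rewrite le_min t0/= divr_ge0.
have gridt n k : (grid n k <= t)%R by rewrite ge_min lexx.
have stepP w n x : tau w = x%:E ->
    ((step n w)%:R / n.+1%:R <= x < (step n w).+1%:R / n.+1%:R)%R.
  move=> e; have x0 : (0 <= x)%R by case: st => /(_ w); rewrite e lee_fin.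
  rewrite /step e /= ler_pdivrMr// ltr_pdivlMr//.
  by apply: truncn_itv; rewrite mulr_ge0.
have mv n : Gmeasurable (F t%:E) (v n).
  (* C 0 is {t <= tau}; C (k' + 1) is the event that tau lies in the grid cell from k' to k' + 1,
     where v n is the value of Z at the right end of the cell. *)
  pose C k := if k is k'.+1 then
      [set w | tau w < (grid n k'.+1)%:E] `\` [set w | tau w < (grid n k')%:E]
    else ~` [set w | tau w < t%:E].
  pose f k w : \bar R := if k is k'.+1 then (Z (grid n k'.+1) w)%:E else 0.
  apply: (Gmeasurable_cover sFt (C := C) (f_ := f)).
  - move=> [|k]; first by apply: sub_sigmaC => //; exact: stopping_time_lt.
    by apply: sub_sigmaD => //; apply: stopping_time_lt => //; rewrite lee_fin.
  - move=> [|k]; first by apply/(GmeasurableP sFt); exact: measurable_cst.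
    by apply: adapted_Gmeasurable => //; rewrite lee_fin.
  - move=> w; have [wt|tw] := ltP (tau w) t%:E; last by exists 0%N; rewrite /= ltNge tw.
    exists (step n w).+1; case: st => /(_ w); case e : (tau w) => [x||]// _ _.
      have /andP[h1 h2] := stepP w n x e; move: wt; rewrite e lte_fin => xt.
      rewrite /C /= e !lte_fin /grid lt_min xt h2; split => //.
      by apply/negP; rewrite -leNgt ge_min h1 orbT.
    by move: wt; rewrite e.
  - move=> [|k] w /=; first by rewrite /v; case: ifP.
    case: st => /(_ w); case e : (tau w) => [x||]// _ _ []; last by rewrite ltNge leey.
    rewrite !lte_fin => h1 h2.
    have xt : (x < t)%R by exact: lt_le_trans h1 (gridt _ _).
    have hk : (k%:R / n.+1%:R <= x)%R.
      by rewrite leNgt; apply/negP => h3; apply: h2; rewrite lt_min xt.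
    have hk1 : (x < k.+1%:R / n.+1%:R)%R by move: h1; rewrite lt_min => /andP[].
    rewrite /v e lte_fin xt; congr ((Z (grid n _.+1) w)%:E).
    apply: truncn_def; rewrite e /=.
    by rewrite -ler_pdivrMr// -ltr_pdivlMr// hk hk1.
have cv : {ae P, forall w, v n w @[n --> \oo] --> (if tau w < t%:E then u w else 0)}.
  case: hZ => _ _ cad _; apply: filterS cad => w [rc _].
  rewrite /v; case: ifPn => [wt|_]; last exact: cvg_cst.
  case: st => /(_ w); rewrite /u; case e : (tau w) wt => [x||]//; rewrite lte_fin => xt + _.
  rewrite lee_fin => x0 /=.
  apply: cvg_EFin; first exact: nearW.
  have rcx : Z y w @[y --> x^'+] --> Z x w by apply: rc; rewrite x0 (lt_le_trans xt).
  move/cvg_at_rightP : rcx; apply; split.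
    by move=> n; rewrite lt_min xt; have /andP[_] := stepP w n x e.
  apply: (@squeeze_cvgr _ _ _ _ (cst x) (fun n => x + n.+1%:R^-1)%R).
  - apply: nearW => n; have /andP[h1 h2] := stepP w n x e.
    rewrite le_min (ltW xt) (ltW h2) /= ge_min; apply/orP; right.
    by rewrite -natr1 mulrDl mul1r lerD2r.
  - exact: cvg_cst.
  - by rewrite -[X in _ --> X]addr0; apply: cvgD; [exact: cvg_cst|exact: cvg_harmonic].
by apply: (Gmeasurable_cvg (P := P) sFt _ mv cv) => A; exact: filtration_null.
Qed.

Let sampled_leT (t : R) B : (0 <= t)%R -> (t <= T)%R -> measurable B ->
  F t%:E (u @^-1` B `&` [set w | tau w <= t%:E]).
Proof.
move=> t0 tT mB; have t0' : 0 <= t%:E by rewrite lee_fin.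
have sFt := filtration_sigma t0'.
have Flt : F t%:E [set w | tau w < t%:E] by exact: stopping_time_lt.
pose v w : \bar R := if tau w < t%:E then u w else 0.
have -> : u @^-1` B `&` [set w | tau w <= t%:E] =
    (v @^-1` B `&` [set w | tau w < t%:E]) `|`
    ((fun w => (Z t w)%:E) @^-1` B `&` ([set w | tau w <= t%:E] `\` [set w | tau w < t%:E])).
  apply/seteqP; split => w /=.
    move=> [Bu wt]; have [lt_wt|le_tw] := ltP (tau w) t%:E; first by left; rewrite /v lt_wt.
    have e : tau w = t%:E by apply/eqP; rewrite eq_le wt.
    by right; rewrite e; split => //; move: Bu; rewrite /u e.
  move=> [[+ wt]|[BZ [wt nwt]]]; first by rewrite /v wt (ltW wt).
  have e : tau w = t%:E by apply/eqP; rewrite eq_le wt leNgt; apply/negP.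
  by split=> //; rewrite /u e.
apply: sub_sigmaU => //; apply: sub_sigmaI => //.
- exact: sampled_lt.
- by apply: adapted_Gmeasurable.
- by apply: sub_sigmaD => //; exact: stopping_time_le.
Qed.

Let sampled_gtT : {ae P, forall w, T%:E < tau w -> u w = 0}.
Proof.
case: hZ => _ _ _ Z0; apply: filterS2 Z0 tau_lty => w Z0; rewrite /u.
by case: (tau w) => [x||]//= _; rewrite lte_fin => /Z0 ->.
Qed.

(** Beyond T there is no path regularity, but there the reward is 0 almost surely. So {T < tau <= t}
    contributes entirely or not at all, according to whether 0 lies in B. *)
Lemma sampled_Gmeasurable : Gmeasurable (stopping_sigma F tau) u.
Proof.
move=> B mB t t0; have sFt := filtration_sigma t0.
have [tT|Tt] := leP t T%:E.
  case: t t0 tT {sFt} => [t||]//; rewrite !lee_fin => t0 tT; exact: sampled_leT.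
have T0 : 0 <= T%:E by rewrite lee_fin ltW.
apply: (@sub_sigma_ae _ _ _ P (F t) sFt _
  ((u @^-1` B `&` [set w | tau w <= T%:E]) `|`
   (([set w | tau w <= t] `\` [set w | tau w <= T%:E]) `&` [set w | B 0]))).
- by move=> A; exact: filtration_null.
- apply: sub_sigmaU => //.
    apply: (filtration_mono T0 (ltW Tt)); apply: sampled_leT => //; exact: ltW.
  apply: sub_sigmaI => //.
    by apply: sub_sigmaD => //; apply: stopping_time_le => //; exact: ltW.
  have [B0|B0] := pselect (B 0).
    by rewrite (_ : [set _ | _] = setT); [exact: sub_sigmaT|rewrite -subTset].
  by rewrite (_ : [set _ | _] = set0); [case: sFt|rewrite -subset0].
- apply: filterS sampled_gtT => w u0 /=; split.
    move=> [[Bu wT]|[[wt /negP]]]; first by split=> //; exact: le_trans (ltW Tt).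
    by rewrite -ltNge => /u0 e B0; split=> //; rewrite e.
  move=> [Bu wt]; have [wT|Tw] := leP (tau w) T%:E; [by left|right].
  by split; [split => //; apply/negP; rewrite -ltNge|rewrite -(u0 Tw)].
Qed.

Lemma gt_stopping_sigma (s : R) : (0 <= s)%R -> stopping_sigma F tau [set w | s%:E < tau w].
Proof.
move=> s0 t t0; have sFt := filtration_sigma t0.
have [st'|ts] := leP s%:E t.
  rewrite (_ : _ `&` _ = [set w | tau w <= t] `\` [set w | tau w <= s%:E]).
    by apply: sub_sigmaD => //; exact: stopping_time_le.
  apply/seteqP; split => w /= [h1 h2]; split => //.
    by rewrite leNgt h1.
  by rewrite ltNge; apply/negP.
rewrite (_ : _ `&` _ = set0); first by case: sFt.
rewrite -subset0 => w /= [h1 h2]; have := lt_trans ts h1.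
by rewrite ltNge h2.
Qed.

End sampling.

End stopping_sigma.

(** * Reduction of the continuous-time setting to the discrete problem *)

Theorem theorem10 (d : measure_display) (Omega : measurableType d) (R : realType)
  (P : probability Omega R) (F : \bar R -> set (set Omega))
  (hF : filtration F) (hFusual : usual_conditions P F)
  (tau : nat -> Omega -> \bar R) (htau : event_times P F tau)
  (T : R) (hT : (0 < T)%R)
  (Z : R -> Omega -> R) (hZ : reward_process P F T Z)
  (alpha B : R) (halpha : (1 < alpha)%R) (hB : (0 < B)%R)
  (hint : \int[P]_w ereal_sup
            (range (fun i : nat => ((Z (fine (tau i w)) w) `^ alpha)%:E))
          <= (B `^ alpha)%:E)
  (kappa : option nat) (hkappa : kappa <> Some 0%N)
  (sigma0 : nat -> Omega -> \bar R) :
  let G := fun i => stopping_sigma F (tau i) in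
  let U := sampled_reward Z tau in
  let sigma := policy P G U kappa sigma0 in
  let sigmastar := optimal_time P G U in
  let Y := snell P G U in
  let Ym := policy_value P G U kappa sigma0 in
  consistent_family P G sigma0 ->
  [/\ forall m i,
        (0 < m)%N \/ no_overshoot P G U kappa sigma0 ->
        {ae P, forall w, sigma m i w <= sigma m.+1 i w},
      forall m i, {ae P, forall w, sigma m.+1 i w <= sigmastar i w},
      forall i, {ae P, forall w, sigmastar i w < +oo},
      forall i, {ae P, forall w, sigma m i w @[m --> \oo] --> sigmastar i w} &
      (forall m i, {ae P, forall w, Ym m i w <= Ym m.+1 i w}) /\
      (forall i, {ae P, forall w, Ym m i w @[m --> \oo] --> Y i w})].
Proof.
move=> G U sigma sigmastar Y Ym cs.
have [stau tau0 tau_lt tau_cv] := htau.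
have [Z0 _ _ ZT] := hZ.
have tau_lty i : {ae P, forall w, tau i w < +oo}.
  case: i => [|i]; last by apply: filterS (tau_lt i) => w [].
  by apply: filterS tau0 => w ->; rewrite ltry.
have tau_nd : {ae P, forall w, nondecreasing_seq (tau ^~ w)}.
  by apply: filterS (ae_foralln tau_lt) => w h; apply/nondecreasing_seqP => i; have [/ltW] := h i.
have tau_ge0 i w : (0 <= fine (tau i w))%R by apply: fine_ge0; case: (stau i).
have sG i : sigma_algebra setT (G i) by exact: stopping_sigma_algebra.
have Gm i : G i `<=` measurable by exact: stopping_sigma_measurable.
have Gnull i A : P.-negligible A -> G i A by exact: stopping_sigma_null.
have Gmono i j : (i <= j)%N -> G i `<=` G j.
  move=> ij; apply: (@stopping_sigma_mono _ _ _ P) => //.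
  by apply: filterS tau_nd => w; exact.
have U0 i w : 0 <= U i w by rewrite lee_fin Z0.
have mU i : Gmeasurable (G i) (U i) by exact: (sampled_Gmeasurable hF hFusual hT hZ).
have mU' i : measurable_fun setT (U i) by exact: (Gmeasurable_measurable (Gm i)).
(* From the moment bound: z <= 1 or z <= z^alpha, so sup_i U_i <= 1 + sup_i U_i^alpha. *)
have intM : P.-integrable setT (fun w => ereal_sup (range (U ^~ w))).
  have sup_measurable (f : nat -> Omega -> \bar R) : (forall i, measurable_fun setT (f i)) ->
      measurable_fun setT (fun w => ereal_sup (range (f ^~ w))).
    move=> mf; have := measurable_fun_esups mf 0%N.
    congr (measurable_fun _ _); apply/funext => w; rewrite /esups /sdrop /=.
    by congr ereal_sup; apply/seteqP; split => _ [n _ <-]; exists n.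
  pose V i w := ((Z (fine (tau i w)) w) `^ alpha)%:E.
  have V0 i w : 0 <= V i w by rewrite lee_fin powR_ge0.
  pose W w := ereal_sup (range (V ^~ w)).
  have VW i w : V i w <= W w by apply: ereal_sup_ubound; exists i.
  have W0 w : 0 <= W w by exact: le_trans (V0 0%N w) (VW 0%N w).
  have mW : measurable_fun setT W.
    apply: sup_measurable => i; apply/measurable_EFinP.
    have mZ : measurable_fun setT (fun w => Z (fine (tau i w)) w) by exact/measurable_EFinP/mU'.
    exact: (measurableT_comp (measurable_powR alpha) mZ).
  have intW : P.-integrable setT W.
    apply/integrableP; split => //; apply: le_lt_trans (ltry (B `^ alpha)).
    apply: le_trans hint; rewrite le_eqVlt; apply/orP; left; apply/eqP.
    by apply: eq_integral => w _; rewrite gee0_abs.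
  have int1W : P.-integrable setT (fun w => 1 + W w).
    by apply: integrableD => //; exact: finite_measure_integrable_cst.
  apply: (le_integrable measurableT _ _ int1W); first exact: sup_measurable.
  move=> w _; rewrite gee0_abs; last first.
    by apply: (le_trans (U0 0%N w)); apply: ereal_sup_ubound; exists 0%N.
  rewrite gee0_abs ?adde_ge0//; apply: ge_ereal_sup => _ [i _ <-].
  apply: (@le_trans _ _ (1 + V i w)); last by rewrite leeD2l.
  rewrite -EFinD lee_fin; set z := Z _ _.
  have z0 : (0 <= z)%R by exact: Z0.
  have [z1|/ltW z1] := leP z 1%R; first by rewrite (le_trans z1)// lerDl powR_ge0.
  apply: (@le_trans _ _ (z `^ alpha)%R); last by rewrite lerDr.
  by rewrite -[leLHS]powRr1//; apply: ler_powR => //; exact: ltW.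
(* The tau_i increase and Z vanishes after T, so rewards stay 0 from i on; since tau_i tends to
   infinity, the event eventually occurs. *)
pose K i : set Omega := [set w | T%:E < tau i w].
apply: (@discrete_policy_iteration _ _ _ P G U K) => //.
- by move=> i; apply: (gt_stopping_sigma hF) => //; exact: ltW.
- move=> i k ik; apply: filterS3 tau_nd (tau_lty k) ZT => w nd fin ZT0 Tw.
  have := lt_le_trans Tw (nd _ _ ik); rewrite /U /sampled_reward.
  by case: (tau k w) fin => [x||]//= _; rewrite lte_fin => /ZT0 ->.
- by apply: filterS tau_cv => w /cvgeyPgt /(_ T).
Qed.
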